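(* We have $$ \mathrm m(1+x_1+x_2+x_3+x_2x_3) =-\frac1{2\pi}\int_0^1{}_2F_1\left(\tfrac12,\tfrac12;1;1-\frac{x^2}{16}\right)\log x\,dx. $$
   Context: For a nonzero Laurent polynomial $P(x_1,\dots,x_N)$, the (logarithmic) Mahler measure is $\mathrm m(P)=\int_{[0,1]^N}\log|P(e^{2\pi i\theta_1},\dots,e^{2\pi i\theta_N})|\,d\theta_1\cdots d\theta_N$. Here ${}_2F_1(a_1,a_2;b_2;z)=\sum_{n\ge0}\frac{(a_1)_n(a_2)_n}{(b_2)_n}\frac{z^n}{n!}$ is the Gauss hypergeometric function with $(a)_n=\Gamma(a+n)/\Gamma(a)$. *)

(* Defs.v *)
From HB Require Import structures.
From mathcomp Require Import all_boot all_order all_algebra.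
From mathcomp Require Import all_classical all_reals all_analysis.
From mathcomp Require Import complex.
Set Implicit Arguments. Unset Strict Implicit. Unset Printing Implicit Defensive.
Import Order.TTheory GRing.Theory Num.Theory.
Import numFieldNormedType.Exports.
Local Open Scope ring_scope.
Local Open Scope classical_set_scope.

Section Defs.
Variable R : realType.

Definition expi2pi (t : R) : R[i] :=
  (Complex (cos (2 * pi * t)) (sin (2 * pi * t))).

Definition P3 (x1 x2 x3 : R[i]) : R[i] := 1 + x1 + x2 + x3 + x2 * x3.

Definition mahler_P3 : \bar R :=
  (\int[((@lebesgue_measure R) \x (@lebesgue_measure R)) \x (@lebesgue_measure R)]_
     (t in (`[0%R, 1%R] `*` `[0%R, 1%R]) `*` `[0%R, 1%R])
     (ln (Normc.normc (P3 (expi2pi t.1.1) (expi2pi t.1.2) (expi2pi t.2))))%:E)%E.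

Definition pochhammer (a : R) (n : nat) : R := \prod_(k < n) (a + k%:R).

Definition hyp2F1_coeff (a1 a2 b2 z : R) (n : nat) : R :=
  pochhammer a1 n * pochhammer a2 n / pochhammer b2 n * z ^+ n / n`!%:R.

Definition hyp2F1 (a1 a2 b2 z : R) : R :=
  limn (series (hyp2F1_coeff a1 a2 b2 z)).

End Defs.

(* Main.v *)
Require Import Defs.
From HB Require Import structures.
From mathcomp Require Import all_boot all_order all_algebra.
From mathcomp Require Import all_classical all_reals all_analysis.
From mathcomp Require Import measurable_realfun.
From mathcomp Require Import complex.
From mathcomp Require Import ring lra.
Import Order.TTheory GRing.Theory Num.Theory.
Import numFieldNormedType.Exports.
Local Open Scope ring_scope.
Local Open Scope classical_set_scope.

(* Since 1 + x1 + x2 + x3 + x2 x3 = x1 + (1 + x2)(1 + x3), Jensen's formula in x1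
   turns the Mahler measure into the mean of log^+ |r| over the torus, with
   |r| = |1 + x2| |1 + x3| = 4 |cos (pi b)| |cos (pi c)|.  As the mean of log |1 + x|
   vanishes, this equals the mean of log^- |r|, that is, of -log r over r < 1.
   Finally, by the substitutions x = 4 sin (pi c) sin (pi b) and
   cos (pi c) = k sin (pi t), k^2 = 1 - x^2 / 16, the density of |r| at x is the
   complete elliptic integral (1 / (2 pi)) 2F1(1/2, 1/2; 1; 1 - x^2 / 16).
   Jensen's formula and the mean value property of the Poisson kernel
   both come from the duplication
   |1 + r z| |1 - r z| = |1 - r^2 z^2|, iterated until r^(2^n) tends to 0. *)

(** * Affine invariance of the Lebesgue integral *)

(** The logarithm is unbounded below, so a mean of a logarithm always enters as the integral of a
    constant minus that logarithm, the constant being a majorant. All integrands are then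
    nonnegative: Tonelli, additivity and monotone convergence apply without integrability proofs,
    and the constant is taken out once finiteness is known. The usual constant is [ln 5], because
    |P3| is at most 5. The passage from log^+ to log^- is what brings in the range 0 < x < 1 of the
    theorem. The Poisson kernel serves to sum a series. Its mean value gives the mean of (1 - y
    sin^2)^-1 in closed form, which turns the geometric series into the binomial series of (1 -
    y)^(-1/2); averaging that series in the same way produces the hypergeometric one. The total
    functions take conventional values: ln is 0 at 0, inversion is 0 at 0, the square root is 0 on
    negative numbers. The first convention forces zeros of the cosine to be removed as null sets
    where a limit or a product is taken under ln; the other two truncate densities for free. *)

Section invariance.
Context {R : realType}.
Notation mu := (@lebesgue_measure R).

(** The pushforward of [mu] along [phi], divided by [c], agrees with [mu] on the intervals []x, y]],
    and these determine Lebesgue measure. *)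
Lemma ge0_integral_comp_scale (phi : R -> R) (c : R) (f : R -> \bar R) :
  0 < c -> measurable_fun setT phi ->
  (forall x y, x < y -> mu (phi @^-1` `]x, y]) = (c * (y - x))%:E) ->
  measurable_fun setT f -> (forall x, 0 <= f x)%E ->
  (\int[mu]_x f (phi x) = c%:E * \int[mu]_x f x)%E.
Proof.
move=> c0 mphi phiE mf f0.
have mphi' : @measurable_fun _ _ (measurableTypeR R) (measurableTypeR R) setT phi := mphi.
pose cV : {nonneg R} := NngNum (ltW (etrans (invr_gt0 c) c0)).
pose m := mscale cV (measure_function_pushforward__canonical__measure_function_Measure mu mphi').
have mE A : measurable A -> mu A = m A.
  apply: (lebesgue_measure_unique (mu := m)) => _ [[x y] _ <-] /=.
  have [xy|yx] := ltP x y; last first.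
    by rewrite set_itv_ge ?bnd_simp -?leNgt// !measure0.
  transitivity (c^-1%:E * mu (phi @^-1` `]x, y]))%E; last by [].
  rewrite phiE// lebesgue_measure_itv/= lte_fin xy -EFinM mulrA mulVf ?gt_eqF// mul1r.
  by rewrite EFinB.
have -> : (\int[mu]_x f x = \int[m]_x f x)%E.
  by apply: eq_measure_integral => A mA _; exact: mE.
rewrite ge0_integral_mscale//= ge0_integral_pushforward// muleA.
by rewrite -EFinM divff ?gt_eqF// mul1e.
Qed.

Lemma ge0_integral_affine (a b : R) (f : R -> \bar R) : 0 < a ->
  measurable_fun setT f -> (forall x, 0 <= f x)%E ->
  (\int[mu]_x f (a * x + b)%R = a^-1%:E * \int[mu]_x f x)%E.
Proof.
move=> a0 mf f0; apply: ge0_integral_comp_scale => //; first by rewrite invr_gt0.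
  by apply: measurable_funD => //; exact: measurable_funM.
move=> x y xy.
have -> : (fun t : R => a * t + b) @^-1` `]x, y] = `](x - b) / a, (y - b) / a].
  apply/seteqP; split => t /=; rewrite !in_itv/= ltr_pdivrMr// ler_pdivlMr//;
    by rewrite ltrBlDr lerBrDr mulrC.
rewrite lebesgue_measure_itv/= lte_fin ltr_pM2r ?invr_gt0// ltrD2r xy -EFinB.
by congr EFin; field; rewrite gt_eqF.
Qed.

Lemma ge0_integral_opp (f : R -> \bar R) :
  measurable_fun setT f -> (forall x, 0 <= f x)%E ->
  (\int[mu]_x f (- x)%R = \int[mu]_x f x)%E.
Proof.
move=> mf f0; rewrite -[RHS]mul1e; apply: ge0_integral_comp_scale => //.
move=> x y xy.
have -> : (fun t : R => - t) @^-1` `]x, y] = `[- y, - x[.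
  by apply/seteqP; split => t /=; rewrite !in_itv/= => /andP[? ?]; apply/andP; split; lra.
rewrite lebesgue_measure_itv/= lte_fin ltrN2 xy -EFinB.
by congr EFin; ring.
Qed.

End invariance.

(** * Functions of period 1 integrated over a period *)

Section periodic.
Context {R : realType}.
Notation mu := (@lebesgue_measure R).
Implicit Types f : R -> \bar R.

(** Half-open intervals tile without overlap, so periods can be cut and glued exactly;
    [integral_itv_cc_co] converts from the closed ones. *)
Lemma ge0_integral_affine_itv (k b x y : R) f : 0 < k ->
  measurable_fun setT f -> (forall t, 0 <= f t)%E ->
  (\int[mu]_(t in `[x, y[) f (k * t + b)%R =
   k^-1%:E * \int[mu]_(t in `[(k * x + b)%R, (k * y + b)%R[) f t)%E.
Proof.
move=> k0 mf f0; rewrite integral_mkcond [in RHS]integral_mkcond.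
rewrite -(ge0_integral_affine k b)//.
- apply: eq_integral => t _; rewrite /patch !mem_setE !in_itv/=.
  by rewrite lerD2r ler_pM2l// ltrD2r ltr_pM2l.
- by apply/(measurable_restrictT _ _).1 => //; exact: measurable_funTS.
- by move=> t; apply: erestrict_ge0.
Qed.

Lemma integral_itv_cc_co (x y : R) f : measurable_fun setT f ->
  (\int[mu]_(t in `[x, y]) f t = \int[mu]_(t in `[x, y[) f t)%E.
Proof. by move=> mf; rewrite !integral_itv_bndoo//; exact: measurable_funTS. Qed.

Lemma ge0_integral_itv_split (x y z : R) f : x <= y -> y <= z ->
  measurable_fun setT f -> (forall t, 0 <= f t)%E ->
  (\int[mu]_(t in `[x, z[) f t =
   \int[mu]_(t in `[x, y[) f t + \int[mu]_(t in `[y, z[) f t)%E.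
Proof.
move=> xy yz mf f0; rewrite -ge0_integral_setU//=.
- by rewrite -itv_bndbnd_setU// bnd_simp.
- exact: measurable_funTS.
- apply: lt_disjoint => u v; rewrite !in_itv/= => /andP[_ uy] /andP[yv _].
  exact: lt_le_trans yv.
Qed.

(** The shifted period [[s, 1 + s[] is cut at 1, and its right piece is the translate of [[0,
    s[]. *)
Lemma ge0_integral_periodic_shift (s : R) f : 0 <= s <= 1 ->
  measurable_fun setT f -> (forall t, 0 <= f t)%E ->
  (forall t, f (t + 1)%R = f t) ->
  (\int[mu]_(t in `[0%R, 1%R]) f (t + s)%R = \int[mu]_(t in `[0%R, 1%R]) f t)%E.
Proof.
move=> /andP[s0 s1] mf f0 pf.
rewrite !integral_itv_cc_co//; last first.
  by apply: measurableT_comp => //; exact: measurable_funD.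
have := @ge0_integral_affine_itv 1 s 0 1 f ltr01 mf f0.
under eq_integral do rewrite mul1r.
rewrite invr1 mul1e mulr0 add0r mulr1 => ->.
rewrite (@ge0_integral_itv_split s 1)//; last by rewrite lerDl.
rewrite (@ge0_integral_itv_split 0 s 1)// addeC; congr (_ + _)%E.
have := @ge0_integral_affine_itv 1 1 0 s f ltr01 mf f0.
rewrite invr1 mul1e mulr0 add0r mul1r addrC => <-.
by apply: eq_integral => t _; rewrite mul1r pf.
Qed.

Lemma ge0_integral_periodic_double f :
  measurable_fun setT f -> (forall t, 0 <= f t)%E ->
  (forall t, f (t + 1)%R = f t) ->
  (\int[mu]_(t in `[0%R, 1%R]) f (2 * t)%R = \int[mu]_(t in `[0%R, 1%R]) f t)%E.
Proof.
move=> mf f0 pf.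
rewrite !integral_itv_cc_co//; last first.
  by apply: measurableT_comp => //; exact: measurable_funM.
under eq_integral do rewrite -(addr0 (2 * _)).
rewrite ge0_integral_affine_itv// !addr0 mulr0 mulr1.
rewrite (@ge0_integral_itv_split 0 1 2)//; last by rewrite ler1n.
have := @ge0_integral_affine_itv 1 1 0 1 f ltr01 mf f0.
rewrite invr1 mul1e mulr0 add0r mul1r => <-.
under [X in (_ * (_ + X))%E]eq_integral do rewrite mul1r pf.
have := integral_ge0 mu (fun (x : R) (_ : `[0%R, 1%R[ x) => f0 x).
(* Half of twice the integral: the value [+oo] is possible and needs its own check. *)
case: integral => [r||]//= r0.
  by rewrite -EFinD -EFinM; congr EFin; field.
by rewrite addye// gt0_muley// lte_fin invr_gt0.
Qed.

End periodic.

(** * Jensen's formula *)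

Section jensen.
Context {R : realType}.
Notation mu := (@lebesgue_measure R).

Lemma measurable_cos_affine (a b : R) : measurable_fun setT (fun t => cos (a * t + b)).
Proof.
apply: continuous_measurable_fun => t.
apply: (@continuous_comp _ _ _ (fun t => a * t + b) (@cos R)); last exact: continuous_cos.
by apply: cvgD; [exact: mulrl_continuous|exact: cvg_cst].
Qed.

(* The squared modulus of 1 + r exp (2 pi i s). *)
Definition circ_norm2 (r s : R) : R := 1 + r ^+ 2 + 2 * r * cos (2 * pi * s).

Lemma circ_norm2_bounds (r s : R) : 0 <= r ->
  (1 - r) ^+ 2 <= circ_norm2 r s <= (1 + r) ^+ 2.
Proof.
move=> r0; rewrite /circ_norm2; have := cos_geN1 (2 * pi * s); have := cos_le1 (2 * pi * s).
by move=> c1 cN1; apply/andP; split; nra.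
Qed.

Lemma circ_norm2_gt0 (r s : R) : 0 <= r < 1 -> 0 < circ_norm2 r s.
Proof.
move=> /andP[r0 r1]; have /andP[+ _] := circ_norm2_bounds r s r0.
by apply: lt_le_trans; rewrite exprn_gt0// subr_gt0.
Qed.

Lemma circ_norm2_half (r s : R) : circ_norm2 r (s + 1 / 2) = circ_norm2 (- r) s.
Proof.
rewrite /circ_norm2.
have -> : 2 * pi * (s + 1 / 2) = 2 * pi * s + pi :> R by field.
by rewrite cosDpi; ring.
Qed.

Lemma circ_norm2_periodic (r s : R) : circ_norm2 r (s + 1) = circ_norm2 r s.
Proof.
rewrite /circ_norm2.
have -> : 2 * pi * (s + 1) = 2 * pi * s + pi *+ 2 :> R by ring.
by rewrite cosD2pi.
Qed.

(** The shift by [1 / 2] is z -> -z. Using it on the right as well, in place of the radius - r^2,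
    keeps the radius nonnegative so that the identity can be iterated. *)
Lemma circ_norm2_double (r s : R) :
  circ_norm2 r s * circ_norm2 r (s + 1 / 2) = circ_norm2 (r ^+ 2) (2 * s + 1 / 2).
Proof.
rewrite !circ_norm2_half /circ_norm2.
have -> : 2 * pi * (2 * s) = (2 * pi * s) *+ 2 :> R by ring.
by rewrite cos_mulr2n; ring.
Qed.

Lemma measurable_circ_norm2 (r : R) : measurable_fun setT (circ_norm2 r).
Proof.
apply: measurable_funD => //; apply: measurable_funM => //.
have := measurable_cos_affine (2 * pi) 0.
by apply: eq_measurable_fun => t _; rewrite addr0.
Qed.

(** Closes both duplication arguments: with ratio 1/2 for Jensen's formula, with ratio [r] for the
    Poisson kernel. *)
Lemma eq0_le_powers (x K r : R) : 0 <= r < 1 -> (forall n, `|x| <= K * r ^+ n) -> x = 0.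
Proof.
move=> /andP[r0 r1] H; apply/eqP; rewrite -normr_eq0; apply/eqP.
have c0 : (fun=> `|x|) @ \oo --> (0 : R).
  apply: (@squeeze_cvgr _ _ _ _ (cst 0) (fun n => K * r ^+ n)).
  - by apply: nearW => n; rewrite /= normr_ge0 H.
  - exact: cvg_cst.
  - rewrite -(mulr0 K); apply: cvgM; first exact: cvg_cst.
    by apply: cvg_expr; rewrite ger0_norm.
exact: (cvg_unique _ (@cvg_cst _ `|x| _ \oo _) c0).
Qed.

(** The first term is the maximum of the second over the circle, which makes [G] nonnegative for 0
    <= r < 1. *)
Let G (r t : R) := 2 * ln (1 + r) - ln (circ_norm2 r t).
Local Notation D := (`[0%R, 1%R]%classic : set R).

Let G_ge0 (r t : R) : 0 <= r < 1 -> 0 <= G r t.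
Proof.
move=> r01; have /andP[r0 r1] := r01; rewrite /G subr_ge0.
have r0' : 0 < 1 + r by rewrite ltr_wpDr.
have /andP[_ le] := circ_norm2_bounds r t r0.
rewrite mulr_natl -lnXn//= ler_ln ?posrE ?exprn_gt0//.
exact: circ_norm2_gt0.
Qed.

Let measurable_G (r : R) : measurable_fun setT (EFin \o G r).
Proof.
apply/measurable_EFinP; apply: measurable_funB => //.
by apply: measurableT_comp => //; exact: measurable_circ_norm2.
Qed.

Let G_periodic (r t : R) : G r (t + 1) = G r t.
Proof. by rewrite /G circ_norm2_periodic. Qed.

(** Logarithm of [circ_norm2_double]; the constant is the discrepancy between twice the maximum at
    [r] and the maximum at [r ^+ 2]. *)
Let G_double (r t : R) : 0 <= r < 1 ->
  G r t + G r (t + 1 / 2) =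
  (4 * ln (1 + r) - 2 * ln (1 + r ^+ 2)) + G (r ^+ 2) (2 * t + 1 / 2).
Proof.
move=> r01; rewrite /G -circ_norm2_double lnM ?posrE ?circ_norm2_gt0//.
by ring.
Qed.

Let i (r : R) := (\int[mu]_(t in D) (G r t)%:E)%E.

Lemma integral_cst01 (c : R) : (\int[mu]_(t in D) c%:E = c%:E)%E.
Proof. by rewrite integral_cst//= lebesgue_measure_itv/= lte_fin ltr01 oppr0 adde0 mule1. Qed.

Let i_ge0 (r : R) : 0 <= r < 1 -> (0 <= i r)%E.
Proof. by move=> r01; apply: integral_ge0 => t _; rewrite lee_fin G_ge0. Qed.

Let i_le (r : R) : 0 <= r < 1 -> (i r <= (2 * ln (1 + r) - 2 * ln (1 - r))%:E)%E.
Proof.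
move=> r01; have /andP[r0 r1] := r01; rewrite -integral_cst01; apply: ge0_le_integral => //.
- by move=> t _; rewrite lee_fin G_ge0.
- by apply: measurable_funTS; exact: measurable_G.
- move=> t _; rewrite lee_fin /G lerD2l lerN2.
  have /andP[le _] := circ_norm2_bounds r t r0.
  by rewrite mulr_natl -lnXn ?subr_gt0//= ler_ln ?posrE ?exprn_gt0 ?subr_gt0// circ_norm2_gt0.
Qed.

Let i_double (r : R) : 0 <= r < 1 ->
  (i r + i r = (4 * ln (1 + r) - 2 * ln (1 + r ^+ 2))%:E + i (r ^+ 2))%E.
Proof.
move=> r01; have /andP[r0 r1] := r01.
have r201 : 0 <= r ^+ 2 < 1 by rewrite sqr_ge0 expr_lt1.
have shift12 (u : R) : 0 <= u < 1 -> i u = (\int[mu]_(t in D) (G u (t + 1 / 2))%:E)%E.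
  move=> u01; rewrite /i -(@ge0_integral_periodic_shift _ (1 / 2) (fun t : R => (G u t)%:E))//.
  - by apply/andP; split; lra.
  - exact: measurable_G.
  - by move=> t; rewrite lee_fin G_ge0.
  - by move=> t; rewrite G_periodic.
have mGs (u : R) : measurable_fun setT (fun t : R => (G u (t + 1 / 2))%:E).
  by apply: (measurableT_comp (measurable_G u)); exact: measurable_funD.
have double (u : R) : 0 <= u < 1 -> i u = (\int[mu]_(t in D) (G u (2 * t + 1 / 2))%:E)%E.
  move=> u01; rewrite shift12//.
  rewrite -(@ge0_integral_periodic_double _ (fun t : R => (G u (t + 1 / 2))%:E))//.
  - by move=> t; rewrite lee_fin G_ge0.
  - by move=> t; rewrite -addrA (addrC 1) addrA G_periodic.
(* One copy of [i r] is moved by half a period and [i (r ^+ 2)] is rewritten at 2t + 1/2, so that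
   [G_double] applies under a single integral. *)
rewrite {2}shift12// (double (r ^+ 2))// -[X in (X + _ = _)%E]/(i r).
have K0 : 0 <= 4 * ln (1 + r) - 2 * ln (1 + r ^+ 2).
  rewrite subr_ge0 (_ : 4 = 2 * 2) -?mulrA; last by rewrite -natrM.
  rewrite ler_pM2l// mulr_natl -lnXn ?ltr_wpDr//= ler_ln ?posrE ?exprn_gt0 ?ltr_wpDr ?sqr_ge0//.
  by nra.
rewrite -[in RHS]integral_cst01 -!ge0_integralD//=.
- by apply: eq_integral => t _; rewrite -!EFinD G_double.
- by move=> t _; rewrite lee_fin G_ge0.
- apply: measurable_funTS; apply: (measurableT_comp (measurable_G _)).
  by apply: measurable_funD => //; exact: measurable_funM.
- by move=> t _; rewrite lee_fin G_ge0.
- by apply: measurable_funTS; exact: measurable_G.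
- by move=> t _; rewrite lee_fin G_ge0.
- by apply: measurable_funTS; exact: (mGs r).
Qed.

Let i_lt1 (r : R) : 0 <= r < 1 -> i r = (2 * ln (1 + r))%:E.
Proof.
move=> r01; have /andP[r0 r1] := r01.
have fini u : 0 <= u < 1 -> i u = (fine (i u))%:E.
  move=> u01; rewrite fineK// ge0_fin_numE ?i_ge0//.
  by apply: le_lt_trans (i_le u u01) _; rewrite ltry.
(* Minus the mean of [ln (circ_norm2 u t)], to be shown zero; duplication halves it in passing from
   [u ^+ 2] to [u]. *)
pose e u := fine (i u) - 2 * ln (1 + u).
have e2 u : 0 <= u < 1 -> e u = e (u ^+ 2) / 2.
  move=> u01; have /andP[u0 u1] := u01; have := i_double u u01.
  rewrite (fini u)// (fini (u ^+ 2)) ?sqr_ge0 ?expr_lt1// -!EFinD => -[] E.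
  by rewrite /e; lra.
(* The bound is uniform on [[0, r]], which is stable under squaring, so every iteration of [e2]
   gains a factor 1/2. *)
have ele u : 0 <= u <= r -> `|e u| <= - 2 * ln (1 - r).
  move=> /andP[u0 ur]; have u01 : 0 <= u < 1 by rewrite u0 (le_lt_trans ur).
  have /andP[_ u1] := u01.
  have lnle : ln (1 - r) <= ln (1 - u).
    by rewrite ler_ln ?posrE ?subr_gt0// lerD2l lerN2.
  have : ln (1 + u) + ln (1 - u) <= 0.
    by rewrite -lnM ?posrE ?subr_gt0 ?ltr_wpDr//; apply: ln_le0; nra.
  have := i_le u u01; have := i_ge0 u u01; rewrite (fini u)// !lee_fin => I0 I1 S.
  have : 0 <= ln (1 + u) by apply: ln_ge0; lra.
  by move=> l0; rewrite ler_norml /e; apply/andP; split; lra.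
have eN n : forall u, 0 <= u <= r -> `|e u| <= - 2 * ln (1 - r) / 2 ^+ n.
  elim: n => [|n IH] u /andP[u0 ur]; first by rewrite expr0 divr1 ele ?u0.
  have u1 : u < 1 by exact: le_lt_trans r1.
  rewrite e2 ?u0// normrM (exprSr 2 n) invfM mulrA normfV (@ger0_norm _ 2)// ler_pM2r ?invr_gt0//.
  by apply: IH; rewrite sqr_ge0/=; nra.
have : e r = 0.
  apply: (@eq0_le_powers (e r) (- 2 * ln (1 - r)) 2^-1) => [|n].
    by rewrite invr_ge0 ler0n/= invf_lt1 ?ltr1n.
  by rewrite exprVn; apply: eN; rewrite r0 lexx.
by rewrite fini// /e => /eqP; rewrite subr_eq0 => /eqP ->.
Qed.

(** That [F] has mean [c] is expressed through a majorant; this lets the majorant be changed. *)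
Lemma integral_sub_const (F : R -> R) (K K1 c : R) : measurable_fun setT F ->
  (forall t, F t <= K) -> (forall t, F t <= K1) ->
  (\int[mu]_(t in D) (K - F t)%:E = (K - c)%:E)%E ->
  (\int[mu]_(t in D) (K1 - F t)%:E = (K1 - c)%:E)%E.
Proof.
move=> mF FK FK1 IK.
have mFK (u : R) : measurable_fun D (fun t : R => (u - F t)%:E).
  by apply/measurable_EFinP; apply: measurable_funB => //; exact: measurable_funTS.
have key (u v : R) : u <= v -> (forall t, F t <= u) ->
    (\int[mu]_(t in D) (v - F t)%:E = \int[mu]_(t in D) (u - F t)%:E + (v - u)%:E)%E.
  move=> uv Fu; rewrite -[(v - u)%:E]integral_cst01 -ge0_integralD//=.
  - by apply: eq_integral => t _; rewrite -EFinD; congr EFin; ring.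
  - by move=> t _; rewrite lee_fin subr_ge0.
  - exact: mFK.
  - by move=> t _; rewrite lee_fin subr_ge0.
(* A smaller majorant is reached by cancelling the finite constant [K - K1]. *)
have [KK1|K1K] := leP K K1.
  by rewrite (key K)// IK -EFinD; congr EFin; ring.
have := key _ _ (ltW K1K) FK1; rewrite IK => E.
transitivity (\int[mu]_(t in D) (K1 - F t)%:E + (K - K1)%:E - (K - K1)%:E)%E.
  by rewrite addeK.
by rewrite -E -EFinB; congr EFin; ring.
Qed.

Lemma jensen_lt1 (r K : R) : 0 <= r < 1 -> 2 * ln (1 + r) <= K ->
  (\int[mu]_(t in D) (K - ln (circ_norm2 r t))%:E = K%:E)%E.
Proof.
move=> r01 rK; rewrite -[in RHS](subr0 K).
have le t : ln (circ_norm2 r t) <= 2 * ln (1 + r) by have := G_ge0 r t r01; rewrite /G subr_ge0.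
apply: (integral_sub_const (fun t => ln (circ_norm2 r t)) (2 * ln (1 + r)) K 0).
- apply: (@measurableT_comp _ _ _ _ _ _ (@ln R)); [exact: measurable_ln|exact: measurable_circ_norm2].
- exact: le.
- by move=> t; apply: le_trans rK.
- by rewrite subr0; exact: i_lt1.
Qed.

End jensen.

(** * Jensen's formula on the unit circle *)

Section jensen_general.
Context {R : realType}.
Notation mu := (@lebesgue_measure R).
Local Notation D := (`[0%R, 1%R]%classic : set R).

Lemma circ_norm2_1 (t : R) : circ_norm2 1 t = 4 * cos (pi * t) ^+ 2.
Proof.
rewrite /circ_norm2; have -> : 2 * pi * t = (pi * t) *+ 2 :> R by ring.
by rewrite cos_mulr2n; ring.
Qed.

Lemma circ_norm2_1_gt0 (t : R) : (D `\ (1 / 2)) t -> 0 < circ_norm2 1 t.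
Proof.
move=> [/=]; rewrite in_itv/= => /andP[t0 t1] t12.
rewrite circ_norm2_1 mulr_gt0// exprn_even_gt0//=.
apply: contra_notN t12 => /eqP; rewrite -cos_pihalf => /cos_inj E.
have pi0 := @pi_gt0 R.
have {}E : pi * t = pi / 2.
  apply: E; rewrite in_itv/=; first by apply/andP; split; nra.
  by apply/andP; split; lra.
by apply: (mulfI (lt0r_neq0 pi0)); rewrite E; field.
Qed.

(* For r < 1, circ_norm2 r = r (e + circ_norm2 1) with e = (1 - r)^2 / r, so the
   case r < 1 gives the case r = 1 by monotone convergence as e decreases to 0. *)
Let rr (n : nat) : R := n.+2%:R / n.+3%:R.
Let eps (n : nat) : R := (n.+2 * n.+3)%:R^-1.

Let rr01 n : 0 <= rr n < 1.
Proof. by rewrite /rr divr_ge0//= ltr_pdivrMr// mul1r ltr_nat. Qed.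

Let rr_gt0 n : 0 < rr n.
Proof. by rewrite /rr divr_gt0. Qed.

Let circ_norm2_rr n t : circ_norm2 (rr n) t = rr n * (eps n + circ_norm2 1 t).
Proof.
rewrite /circ_norm2 /rr /eps natrM.
have -> : n.+3%:R = n.+2%:R + 1 :> R by rewrite -[in LHS]addn1 natrD.
have : 0 < n.+2%:R :> R by [].
move: n.+2%:R => x x0; field.
by apply/andP; split; apply: lt0r_neq0; lra.
Qed.

Let eps_cvg0 : eps @ \oo --> (0 : R).
Proof.
apply: (@squeeze_cvgr _ _ _ _ (cst 0) (@harmonic R)).
- apply: nearW => n; rewrite /= /eps invr_ge0 ler0n /harmonic lef_pV2 ?posrE ?ltr0n//.
  by rewrite ler_nat mulSn; apply: leq_trans (leq_addr _ _); do 2 apply: leqW.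
- exact: cvg_cst.
- exact: cvg_harmonic.
Qed.

Let eps_gt0 n : 0 < eps n.
Proof. by rewrite invr_gt0. Qed.

Let eps_ninc n m : (n <= m)%N -> eps m <= eps n.
Proof. by move=> nm; rewrite lef_pV2 ?posrE// ler_nat leq_mul. Qed.

Let lnrr_cvg : ln (rr n) @[n --> \oo] --> (0 : R).
Proof.
rewrite -(@ln1 R).
apply: (@continuous_cvg _ _ _ _ _ _ (@ln R)); first exact: continuous_ln.
have -> : rr = (fun n => 1 - n.+3%:R^-1).
  apply/funext => n; rewrite /rr.
  have -> : n.+3%:R = n.+2%:R + 1 :> R by rewrite -[in LHS]addn1 natrD.
  have : 0 < n.+2%:R :> R by [].
  move: n.+2%:R => x x0; field.
  by apply: lt0r_neq0; lra.
rewrite -[X in _ --> X]subr0; apply: cvgB; first exact: cvg_cst.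
have := @cvg_harmonic R.
by rewrite -cvg_shiftS -cvg_shiftS.
Qed.

(** The constant comes from [eps n] being at most 1 and [circ_norm2 1 t] at most 4; hence [H n] is
    nonnegative, and it increases with [n]. *)
Let H (n : nat) (t : R) := ln 5 - ln (eps n + circ_norm2 1 t).

Let integral_H n : (\int[mu]_(t in D) (H n t)%:E = (ln 5 + ln (rr n))%:E)%E.
Proof.
rewrite -(jensen_lt1 (rr n) _ (rr01 n)); last first.
  (* The side condition of [jensen_lt1] amounts to (1 + r)^2 <= 5 r for r = [rr n], which is at
     least 2/3. *)
  have r0 := rr_gt0 n; have p0 : 0 < 1 + rr n by lra.
  rewrite mulr_natl -lnXn// -lnM ?posrE// ler_ln ?posrE ?mulr_gt0 ?exprn_gt0//.
  rewrite /rr; have -> : n.+3%:R = n.+2%:R + 1 :> R by rewrite -[in LHS]addn1 natrD.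
  have : 2 <= n.+2%:R :> R by rewrite ler_nat.
  move: n.+2%:R => x x0.
  have -> : 1 + x / (x + 1) = (2 * x + 1) / (x + 1) by field; rewrite gt_eqF//; lra.
  rewrite expr_div_n ler_pdivrMr ?exprn_gt0//; last lra.
  have -> : 5 * (x / (x + 1)) * (x + 1) ^+ 2 = 5 * x * (x + 1) by field; rewrite gt_eqF//; lra.
  by nra.
apply: eq_integral => t _; rewrite circ_norm2_rr lnM ?posrE//.
  by congr EFin; rewrite /H; ring.
have /andP[+ _] := circ_norm2_bounds (1 : R) t ler01.
by rewrite subrr expr0n/=; have := eps_gt0 n; lra.
Qed.

Let cn1_ge0 t : 0 <= circ_norm2 (1 : R) t.
Proof.
by have /andP[+ _] := circ_norm2_bounds (1 : R) t ler01; rewrite subrr expr0n/=.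
Qed.

Let cn1_le4 t : circ_norm2 (1 : R) t <= 4.
Proof.
have /andP[_] := circ_norm2_bounds (1 : R) t ler01; lra.
Qed.

Let measurable_H n : measurable_fun setT (EFin \o H n).
Proof.
apply/measurable_EFinP; apply: measurable_funB => //.
apply: (@measurableT_comp _ _ _ _ _ _ (@ln R)); first exact: measurable_ln.
by apply: measurable_funD => //; exact: measurable_circ_norm2.
Qed.

(** At [1 / 2] the cosine vanishes and the convention ln 0 = 0 breaks both the limit of ln and the
    logarithm of a product; this null point is discarded. *)
Lemma integral_setD1_half (f : R -> \bar R) : measurable_fun setT f ->
  (\int[mu]_(t in D `\ (1 / 2)%R) f t = \int[mu]_(t in D) f t)%E.
Proof.
by move=> mf; apply: integral_setD1; [exact: measurableD|exact: measurable_funTS].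
Qed.

Lemma jensen_eq1_ln5 :
  (\int[mu]_(t in D) (ln 5 - ln (circ_norm2 1 t))%:E = (ln 5)%:E)%E.
Proof.
rewrite -integral_setD1_half; last first.
  apply/measurable_EFinP; apply: measurable_funB => //.
  apply: (@measurableT_comp _ _ _ _ _ _ (@ln R)); first exact: measurable_ln.
  exact: measurable_circ_norm2.
have pos n t : 0 < eps n + circ_norm2 1 t by rewrite ltr_wpDr.
have mD' : measurable (D `\ (1 / 2) : set R) by exact: measurableD.
have cvgH : (\int[mu]_(t in D `\ (1 / 2)%R) (H n t)%:E)%E @[n --> \oo] -->
    (\int[mu]_(t in D `\ (1 / 2)%R) limn (fun n => (H n t)%:E))%E.
  apply: cvg_monotone_convergence => //.
  - by move=> n; apply: measurable_funTS; exact: measurable_H.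
  - move=> n t _; rewrite lee_fin /H subr_ge0 ler_ln ?posrE//.
    have : eps n <= 1 by rewrite invf_le1// ler1n.
    by have := cn1_le4 t; lra.
  - move=> t _ n m nm; rewrite lee_fin /H lerD2l lerN2 ler_ln ?posrE//.
    by rewrite lerD2r eps_ninc.
have cvgH' : (\int[mu]_(t in D `\ (1 / 2)%R) (H n t)%:E)%E @[n --> \oo] --> (ln 5 : R)%:E.
  rewrite (_ : (fun n => _) = (fun n => (ln 5 + ln (rr n))%:E)); last first.
    by apply/funext => n; rewrite integral_setD1_half//; exact: measurable_H.
  apply: cvg_EFin; first exact: nearW.
  rewrite -[X in _ --> X]addr0; apply: cvgD; [exact: cvg_cst|exact: lnrr_cvg].
rewrite -(cvg_unique _ cvgH cvgH')//.
apply: eq_integral => t /set_mem tD; apply/esym/cvg_lim => //.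
apply: cvg_EFin; first exact: nearW.
apply: cvgB; first exact: cvg_cst.
apply: (@continuous_cvg _ _ _ _ _ _ (@ln R)).
  by apply: continuous_ln; exact: circ_norm2_1_gt0.
by rewrite -[X in _ --> X]add0r; apply: cvgD; [exact: eps_cvg0|exact: cvg_cst].
Qed.

End jensen_general.

(** * Jensen's formula for any real radius and phase, and the modulus of P3 *)

Section jensen_all.
Context {R : realType}.
Notation mu := (@lebesgue_measure R).
Local Notation D := (`[0%R, 1%R]%classic : set R).

Definition ln_plus (r : R) : R := ln (Num.max 1 `|r|).

Lemma ln_plus_le1 (r : R) : `|r| <= 1 -> ln_plus r = 0.
Proof. by move=> r1; rewrite /ln_plus max_l// ln1. Qed.

Lemma ln_plus_ge1 (r : R) : 1 <= `|r| -> ln_plus r = ln `|r|.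
Proof. by move=> r1; rewrite /ln_plus max_r. Qed.

Lemma ln_circ_norm2_le (r s : R) : 0 <= r -> ln (circ_norm2 r s) <= 2 * ln (1 + r).
Proof.
move=> r0; have /andP[le0 le] := circ_norm2_bounds r s r0.
have [c0|c0] := ltP 0 (circ_norm2 r s).
  have p0 : 0 < 1 + r by lra.
  by rewrite mulr_natl -lnXn// ler_ln ?posrE ?exprn_gt0.
by rewrite ln0// mulr_ge0// ln_ge0// lerDl.
Qed.

Lemma jensen_ge0 (r K : R) : 0 <= r -> 2 * ln (1 + r) <= K ->
  (\int[mu]_(t in D) (K - ln (circ_norm2 r t))%:E = (K - 2 * ln_plus r)%:E)%E.
Proof.
move=> r0 rK; have [r1|r1|r1] := ltgtP r 1.
- by rewrite jensen_lt1 ?r0// ln_plus_le1 ?mulr0 ?subr0// (ger0_norm r0) ltW.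
- have rp : 0 < r by apply: lt_trans r1.
  have rV01 : 0 <= r^-1 < 1 by rewrite invr_ge0 r0/= invf_lt1.
  (* Inversion in the unit circle brings the radius below 1; the factor [r ^+ 2] supplies the term
     [2 * ln_plus r]. *)
  have E t : circ_norm2 r t = r ^+ 2 * circ_norm2 r^-1 t.
    by rewrite /circ_norm2; field; exact: lt0r_neq0.
  rewrite ln_plus_ge1 (ger0_norm r0) ?(ltW r1)// -(jensen_lt1 r^-1)//; last first.
    have rp' : 0 < 1 + r^-1 by rewrite ltr_wpDr ?invr_ge0.
    rewrite lerBrDr -mulrDr -lnM ?posrE//.
    by rewrite (_ : (1 + r^-1) * r = 1 + r)//; field; rewrite gt_eqF.
  apply: eq_integral => t _; rewrite E lnM ?posrE ?exprn_gt0 ?circ_norm2_gt0// lnXn//.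
  by congr EFin; rewrite -mulr_natl; ring.
- rewrite r1 in rK *; rewrite ln_plus_le1 ?normr1// mulr0.
  (* [jensen_eq1_ln5] has the majorant [ln 5], whereas [K] may be as small as ln 4. *)
  apply: (integral_sub_const (fun t => ln (circ_norm2 1 t)) (ln 5) K 0).
  + apply: (@measurableT_comp _ _ _ _ _ _ (@ln R)); first exact: measurable_ln.
    exact: measurable_circ_norm2.
  + move=> t; apply: le_trans (ln_circ_norm2_le _ _ _) _ => //.
    by rewrite mulr_natl -lnXn// ler_ln ?posrE ?exprn_gt0//; lra.
  + by move=> t; apply: le_trans rK; exact: ln_circ_norm2_le.
  + by rewrite subr0; exact: jensen_eq1_ln5.
Qed.

(** A negative radius is a positive one with the phase moved by half a period; [s'] stays in
    [[0, 1]], as [ge0_integral_periodic_shift] requires. *)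
Lemma circ_norm2_abs (r s : R) : exists2 s', 0 <= s' <= 1 &
  forall t, circ_norm2 r (t + s) = circ_norm2 `|r| (t + s' + s).
Proof.
have [r0|r0] := leP 0 r.
  by exists 0 => [|t]; [rewrite lexx ler01|rewrite addr0 ger0_norm].
exists (1 / 2) => [|t]; first by apply/andP; split; lra.
by rewrite -addrA (addrC _ s) addrA circ_norm2_half ltr0_norm// opprK.
Qed.

Lemma ln_circ_norm2_le_abs (r s : R) : ln (circ_norm2 r s) <= 2 * ln (1 + `|r|).
Proof.
have [s' _ E] := circ_norm2_abs r 0.
by rewrite -[s]addr0 E ln_circ_norm2_le.
Qed.

Lemma jensen (r K s : R) : 0 <= s <= 1 -> 2 * ln (1 + `|r|) <= K ->
  (\int[mu]_(t in D) (K - ln (circ_norm2 r (t + s)))%:E = (K - 2 * ln_plus r)%:E)%E.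
Proof.
move=> s01 rK; have [s' s'01 E] := circ_norm2_abs r 0.
have mF u : measurable_fun setT (fun t : R => (K - ln (circ_norm2 u t))%:E).
  apply/measurable_EFinP; apply: measurable_funB => //.
  apply: (@measurableT_comp _ _ _ _ _ _ (@ln R)); first exact: measurable_ln.
  exact: measurable_circ_norm2.
have F0 u t : `|u| = `|r| -> (0 <= (K - ln (circ_norm2 u t))%:E)%E.
  move=> ur; rewrite lee_fin subr_ge0; apply: le_trans rK.
  by rewrite -ur; exact: ln_circ_norm2_le_abs.
rewrite (@ge0_integral_periodic_shift _ s (fun t : R => (K - ln (circ_norm2 r t))%:E))//; last 2 first.
- by move=> t; exact: F0.
- by move=> t; rewrite circ_norm2_periodic.
have -> : ln_plus r = ln_plus `|r| by rewrite /ln_plus normr_id.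
rewrite -jensen_ge0//.
rewrite -(@ge0_integral_periodic_shift _ s' (fun t : R => (K - ln (circ_norm2 `|r| t))%:E))//.
- by apply: eq_integral => t _; rewrite -[in LHS](addr0 t) E addr0.
- by move=> t; rewrite F0// normr_id.
- by move=> t; rewrite circ_norm2_periodic.
Qed.

(** Write e(t) for exp(2 pi i t). Since 1 + e(b) = 2 cos(pi b) e(b/2), the product (1 + x2)(1 + x3)
    is a real number r times e((b + c)/2); dividing P3 by this unit leaves |r + e(a - (b +
    c)/2)|. *)
Lemma normc_P3 (a b c : R) :
  Normc.normc (P3 (expi2pi a) (expi2pi b) (expi2pi c)) =
  Num.sqrt (circ_norm2 (4 * cos (pi * b) * cos (pi * c)) (a - (b + c) / 2)).
Proof.
rewrite /P3 /expi2pi /=; congr Num.sqrt; rewrite /circ_norm2.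
have -> : 2 * pi * b = (pi * b) *+ 2 by ring.
have -> : 2 * pi * c = (pi * c) *+ 2 by ring.
have -> : 2 * pi * (a - (b + c) / 2) = 2 * pi * a - (pi * b + pi * c) by field.
rewrite !cos_mulr2n !sin_mulr2n cosB cosD sinD.
have := cos2Dsin2 (2 * pi * a); have := cos2Dsin2 (pi * b); have := cos2Dsin2 (pi * c).
set ca := cos (2 * pi * a); set sa := sin (2 * pi * a).
set cb := cos (pi * b); set sb := sin (pi * b).
set cc := cos (pi * c); set sc := sin (pi * c).
move=> Hc Hb Ha; set r := 4 * cb * cc.
(* Grouped so that each sum of squares stands as a factor, ready to be replaced by 1. *)
transitivity ((ca ^+ 2 + sa ^+ 2) + r ^+ 2 * ((cb ^+ 2 + sb ^+ 2) * (cc ^+ 2 + sc ^+ 2))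
  + 2 * r * (ca * (cb * cc - sb * sc) + sa * (sb * cc + cb * sc))).
  by rewrite /r; ring.
by rewrite Ha Hb Hc; ring.
Qed.

Lemma ln_sqrt (x : R) : 0 <= x -> ln (Num.sqrt x) = ln x / 2.
Proof.
rewrite le_eqVlt => /predU1P[<-|x0]; first by rewrite sqrtr0 ln0// mul0r.
by rewrite -{2}(sqr_sqrtr (ltW x0)) lnXn ?sqrtr_gt0//; field.
Qed.

End jensen_all.

(** * The Poisson kernel and the hypergeometric series *)

Section poisson.
Context {R : realType}.
Notation mu := (@lebesgue_measure R).
Local Notation D := (`[0%R, 1%R]%classic : set R).

(** Inversion is discontinuous at 0; x^-1 = x (x^2)^-1 reduces it to a real power of a nonnegative
    base. *)
Lemma measurable_invr : measurable_fun setT (GRing.inv : R -> R).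
Proof.
have -> : (GRing.inv : R -> R) = fun x => x * (x ^+ 2) `^ (-1).
  apply/funext => x; rewrite powR_inv1 ?sqr_ge0// expr2 invfM mulrA.
  by have [->|x0] := eqVneq x 0; [rewrite invr0 !mul0r|rewrite divff// mul1r].
apply: measurable_funM => //.
by apply: (@measurableT_comp _ _ _ _ _ _ (fun x : R => x `^ (-1))) => //; exact: measurable_powR.
Qed.

(** The Poisson kernel of the disc, turned by half a period because of the sign in [circ_norm2]. *)
Let p (r t : R) := (1 - r ^+ 2) / circ_norm2 r t.

Let p_bounds (r t : R) : 0 <= r < 1 -> (1 - r) / (1 + r) <= p r t <= (1 + r) / (1 - r).
Proof.
move=> r01; have /andP[r0 r1] := r01; have c0 := circ_norm2_gt0 r t r01.
have /andP[le1 le2] := circ_norm2_bounds r t r0.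
have ? : 0 < 1 + r by lra.
have ? : 0 < 1 - r by lra.
rewrite /p ler_pdivlMr// ler_pdivrMr//; apply/andP; split.
  rewrite mulrAC ler_pdivrMr//; nra.
rewrite mulrAC ler_pdivlMr//; nra.
Qed.

Let p_ge0 (r t : R) : 0 <= r < 1 -> 0 <= p r t.
Proof.
move=> r01; have /andP[+ _] := p_bounds r t r01; have /andP[r0 r1] := r01.
by apply: le_trans; rewrite divr_ge0//; lra.
Qed.

Let measurable_p (r : R) : measurable_fun setT (EFin \o p r).
Proof.
apply/measurable_EFinP; apply: measurable_funM => //.
by apply: (measurableT_comp measurable_invr); exact: measurable_circ_norm2.
Qed.

Let p_periodic (r t : R) : p r (t + 1) = p r t.
Proof. by rewrite /p circ_norm2_periodic. Qed.

(** The two denominators have sum 2 (1 + r^2) and, by [circ_norm2_double], the denominator for r^2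
    as product; then (1 - r^2)(1 + r^2) = 1 - r^4. *)
Let p_double (r t : R) : 0 <= r < 1 ->
  p r t + p r (t + 1 / 2) = 2 * p (r ^+ 2) (2 * t + 1 / 2).
Proof.
move=> r01; have c1 := circ_norm2_gt0 r t r01; have c2 := circ_norm2_gt0 r (t + 1 / 2) r01.
rewrite /p -circ_norm2_double.
have S : circ_norm2 r t + circ_norm2 r (t + 1 / 2) = 2 * (1 + r ^+ 2).
  by rewrite circ_norm2_half /circ_norm2; ring.
move: (circ_norm2 r t) (circ_norm2 r (t + 1 / 2)) c1 c2 S => x y x0 y0 S.
transitivity ((1 - r ^+ 2) * (x + y) / (x * y)).
  by field; rewrite !gt_eqF.
by rewrite S; field; rewrite !gt_eqF.
Qed.

Let i (r : R) := (\int[mu]_(t in D) (p r t)%:E)%E.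

(** Both bounds tend to 1 as [r] tends to 0, which identifies the limit of the iteration. *)
Let i_bounds (r : R) : 0 <= r < 1 ->
  (((1 - r) / (1 + r))%:E <= i r <= ((1 + r) / (1 - r))%:E)%E.
Proof.
move=> r01; have /andP[r0 r1] := r01.
apply/andP; split; rewrite -integral_cst01.
  apply: ge0_le_integral => //.
  - by move=> t _; rewrite lee_fin divr_ge0//; lra.
  - by apply: measurable_funTS; exact: measurable_p.
  - by move=> t _; rewrite lee_fin; have /andP[] := p_bounds r t r01.
apply: ge0_le_integral => //.
- by move=> t _; rewrite lee_fin p_ge0.
- by apply: measurable_funTS; exact: measurable_p.
- by move=> t _; rewrite lee_fin; have /andP[] := p_bounds r t r01.
Qed.

Let i_fin (r : R) : 0 <= r < 1 -> i r \is a fin_num.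
Proof.
move=> r01; have /andP[l u] := i_bounds r r01; apply/fin_numP; split.
  by apply: contraTneq l => ->; rewrite leeNy_eq.
by apply: contraTneq u => ->; rewrite leye_eq.
Qed.

Let i_double (r : R) : 0 <= r < 1 -> i r = i (r ^+ 2).
Proof.
move=> r01; have /andP[r0 r1] := r01.
have r201 : 0 <= r ^+ 2 < 1 by rewrite sqr_ge0 expr_lt1.
have shift12 (u : R) : 0 <= u < 1 -> i u = (\int[mu]_(t in D) (p u (t + 1 / 2))%:E)%E.
  move=> u01; rewrite /i -(@ge0_integral_periodic_shift _ (1 / 2) (fun t : R => (p u t)%:E))//.
  - by apply/andP; split; lra.
  - exact: measurable_p.
  - by move=> t; rewrite lee_fin p_ge0.
  - by move=> t; rewrite p_periodic.
have mps (u : R) : measurable_fun setT (fun t : R => (p u (t + 1 / 2))%:E).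
  by apply: (measurableT_comp (measurable_p u)); exact: measurable_funD.
have double (u : R) : 0 <= u < 1 -> i u = (\int[mu]_(t in D) (p u (2 * t + 1 / 2))%:E)%E.
  move=> u01; rewrite shift12//.
  rewrite -(@ge0_integral_periodic_double _ (fun t : R => (p u (t + 1 / 2))%:E))//.
  - by move=> t; rewrite lee_fin p_ge0.
  - by move=> t; rewrite -addrA (addrC 1) addrA p_periodic.
have E : (i r + i r = 2%:E * i (r ^+ 2))%E.
  rewrite {2}shift12// (double (r ^+ 2))// -ge0_integralZl//=; last 2 first.
  - apply: measurable_funTS; apply: (measurableT_comp (measurable_p _)).
    by apply: measurable_funD => //; exact: measurable_funM.
  - by move=> t _; rewrite lee_fin p_ge0.
  rewrite /i -ge0_integralD//=.
  - by apply: eq_integral => t _; rewrite -EFinD -EFinM p_double.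
  - by move=> t _; rewrite lee_fin p_ge0.
  - by apply: measurable_funTS; exact: measurable_p.
  - by move=> t _; rewrite lee_fin p_ge0.
  - by apply: measurable_funTS; exact: mps.
move: E; rewrite -(fineK (i_fin r r01)) -(fineK (i_fin (r ^+ 2) r201)) -EFinD -EFinM => -[] E.
by congr EFin; lra.
Qed.

Lemma poisson_integral (r : R) : 0 <= r < 1 ->
  (\int[mu]_(t in D) ((1 - r ^+ 2) / circ_norm2 r t)%:E = 1)%E.
Proof.
move=> r01; have /andP[r0 r1] := r01.
have step n : i r = i (r ^+ (2 ^ n)).
  elim: n => [|n ->]; first by rewrite expn0 expr1.
  by rewrite expnSr exprM i_double// exprn_ge0//= exprn_ilt1// -lt0n expn_gt0.
suff : fine (i r) - 1 = 0.
  by move/eqP; rewrite subr_eq0 => /eqP E; rewrite -[LHS]/(i r) -(fineK (i_fin r r01)) E.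
(* With u = r^(2^n), the distance of (1 + u)/(1 - u) from 1 is 2u/(1 - u); the constant follows from
   u <= r and u <= r^n. *)
apply: (@eq0_le_powers R _ (2 / (1 - r)) r) => // n.
have u01 : 0 <= r ^+ (2 ^ n) < 1 by rewrite exprn_ge0//= exprn_ilt1// -lt0n expn_gt0.
have ur : r ^+ (2 ^ n) <= r ^+ n.
  by apply: ler_wiXn2l => //; [exact: ltW|exact/ltnW/ltn_expl].
have ur1 : r ^+ (2 ^ n) <= r.
  by rewrite -[leRHS]expr1; apply: ler_wiXn2l => //; [exact: ltW|rewrite expn_gt0].
have := i_bounds _ u01; rewrite (step n) -(fineK (i_fin _ u01)) !lee_fin.
move: (r ^+ (2 ^ n)) (r ^+ n) u01 ur ur1 => u v /andP[u0 u1] uv ur.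
have a1 : 1 - 2 * u <= (1 - u) / (1 + u) by rewrite ler_pdivlMr; nra.
have a2 : (1 + u) / (1 - u) = 1 + 2 * u / (1 - u) by field; rewrite gt_eqF//; lra.
have a3 : 2 * u / (1 - u) <= 2 * v / (1 - r).
  apply: ler_pM; [lra|rewrite invr_ge0; lra|lra|].
  by rewrite lef_pV2 ?posrE; lra.
have a4 : 2 * u <= 2 * u / (1 - u) by rewrite ler_pdivlMr; nra.
move=> /andP[b1 b2]; rewrite -/(fine _) mulrAC ler_norml; apply/andP; split; lra.
Qed.

Lemma sin_kernel_integral (y : R) : 0 <= y < 1 ->
  (\int[mu]_(t in D) ((1 - y * sin (pi * t) ^+ 2)^-1)%:E = ((Num.sqrt (1 - y))^-1)%:E)%E.
Proof.
move=> /andP[y0 y1]; set s := Num.sqrt (1 - y).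
have s0 : 0 < s by rewrite sqrtr_gt0; lra.
have s2 : s ^+ 2 = 1 - y by rewrite sqr_sqrtr//; lra.
have s1 : s <= 1 by rewrite leNgt; apply/negP => h; nra.
(* Chosen so that 4r/(1 + r)^2 = y. Then [circ_norm2 r t] is (1 + r)^2 (1 - y sin^2(pi t)), and the
   Poisson kernel is [s] times the integrand. *)
pose r := (1 - s) / (1 + s).
have r01 : 0 <= r < 1.
  by apply/andP; split; [rewrite divr_ge0//; lra|rewrite ltr_pdivrMr; lra].
have /andP[r0 r1] := r01.
transitivity (\int[mu]_(t in D) ((s^-1)%:E * ((1 - r ^+ 2) / circ_norm2 r t)%:E))%E.
  apply: eq_integral => t _; rewrite -EFinM; congr EFin.
  have c0 := circ_norm2_gt0 r t r01.
  have cE : circ_norm2 r t = (2 / (1 + s)) ^+ 2 * (1 - y * sin (pi * t) ^+ 2).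
    have -> : y = 1 - s ^+ 2 by rewrite s2; ring.
    rewrite /circ_norm2 (_ : 2 * pi * t = (pi * t) *+ 2); last by ring.
    rewrite cos_mulr2n cos2sin2 /r; field.
    by apply: lt0r_neq0; lra.
  move: c0; rewrite cE; move: (1 - y * _) => z.
  rewrite pmulr_rgt0 ?exprn_gt0 ?divr_gt0//; last lra.
  move=> z0; rewrite /r; field.
  by rewrite !gt_eqF//; lra.
rewrite ge0_integralZl//; last 3 first.
- by apply: measurable_funTS; exact: measurable_p.
- by move=> t _; rewrite lee_fin; exact: p_ge0.
- by rewrite lee_fin invr_ge0 ltW.
by rewrite poisson_integral// mule1.
Qed.

End poisson.

(** * Wallis integrals and termwise integration of power series *)

Section wallis.
Context {R : realType}.
Notation mu := (@lebesgue_measure R).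
Local Notation D := (`[0%R, 1%R]%classic : set R).

Lemma is_derive_sin_pi (t : R) : is_derive t 1 (fun x => sin (pi * x)) (pi * cos (pi * t)).
Proof.
have h : is_derive t 1 (fun x : R => pi * x) pi.
  by apply: is_derive_eq; rewrite scaler1.
by rewrite mulrC; exact: (is_derive1_comp (is_derive_sin (pi * t)) h).
Qed.

Lemma is_derive_cos_pi (t : R) : is_derive t 1 (fun x => cos (pi * x)) (- (pi * sin (pi * t))).
Proof.
have h : is_derive t 1 (fun x : R => pi * x) pi.
  by apply: is_derive_eq; rewrite scaler1.
by rewrite mulrC -mulNr; exact: (is_derive1_comp (is_derive_cos (pi * t)) h).
Qed.

Lemma continuous_sin_pi : continuous (fun x : R => sin (pi * x)).
Proof. by move=> t; apply: differentiable_continuous; apply/derivable1_diffP; case: (is_derive_sin_pi t). Qed.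

Lemma continuous_cos_pi : continuous (fun x : R => cos (pi * x)).
Proof. by move=> t; apply: differentiable_continuous; apply/derivable1_diffP; case: (is_derive_cos_pi t). Qed.

Lemma measurable_sin_pi : measurable_fun setT (fun x : R => sin (pi * x)).
Proof. by apply: continuous_measurable_fun; exact: continuous_sin_pi. Qed.

Lemma measurable_cos_pi : measurable_fun setT (fun x : R => cos (pi * x)).
Proof. by apply: continuous_measurable_fun; exact: continuous_cos_pi. Qed.

Lemma sin_pi_ge0 (t : R) : 0 <= t <= 1 -> 0 <= sin (pi * t).
Proof.
move=> /andP[t0 t1]; have := @pi_gt0 R => p0.
by apply: sin_ge0_pi; apply/andP; split; nra.
Qed.

(** This is C(2n, n)/4^n: both the mean of sin^(2n) and the n-th coefficient of (1 - z)^(-1/2). *)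
Definition wallis (n : nat) : R := pochhammer (1 / 2) n / n`!%:R.

Lemma wallisS n : wallis n.+1 = (2 * n%:R + 1) / (2 * n%:R + 2) * wallis n.
Proof.
rewrite /wallis /pochhammer big_ord_recr/= factS natrM -natr1.
field.
have h : 0 <= n%:R :> R by [].
apply/and3P; split.
- by rewrite pnatr_eq0 -lt0n fact_gt0.
- by apply: lt0r_neq0; lra.
- by apply: lt0r_neq0; lra.
Qed.

Lemma wallis_ge0 n : 0 <= wallis n.
Proof.
by rewrite divr_ge0//; apply: prodr_ge0 => i _; rewrite addr_ge0 ?divr_ge0.
Qed.

(** Vanishes at 0 and 1, while its derivative, written with sines only, relates the powers n and n +
    2: the integration by parts behind the Wallis recursion. *)
Let F n (t : R) : R := sin (pi * t) ^+ n.+1 * cos (pi * t).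

Let dF n (t : R) : is_derive t 1 (F n)
  (pi * (n.+1%:R * sin (pi * t) ^+ n - n.+2%:R * sin (pi * t) ^+ n.+2)).
Proof.
have := is_deriveM (is_deriveX n.+1 (is_derive_sin_pi t)) (is_derive_cos_pi t).
rewrite /= => H.
have -> : F n = (fun x => sin (pi * x)) ^+ n.+1 * (fun x => cos (pi * x)).
  by apply/funext => x; rewrite /F fctE exprfctE.
apply: is_derive_eq H _.
rewrite /GRing.scale/= exprfctE.
have cs : cos (pi * t) ^+ 2 = 1 - sin (pi * t) ^+ 2 by rewrite cos2sin2.
rewrite -[n.+2%:R]natr1 -[n.+1%:R]natr1 !exprS.
transitivity (pi * (n%:R + 1) * sin (pi * t) ^+ n * cos (pi * t) ^+ 2
  - pi * sin (pi * t) ^+ 2 * sin (pi * t) ^+ n); first by ring.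
by rewrite cs; ring.
Qed.

Lemma integral_sin_rec n :
  (n.+2%:R%:E * \int[mu]_(t in D) (sin (pi * t) ^+ n.+2)%:E =
   n.+1%:R%:E * \int[mu]_(t in D) (sin (pi * t) ^+ n)%:E)%E.
Proof.
have csX m (c : R) : continuous (fun t : R => c * sin (pi * t) ^+ m).
  move=> t; apply: cvgM; first exact: cvg_cst.
  by apply: (@continuous_comp _ _ _ (fun t : R => sin (pi * t)) (fun x => x ^+ m));
    [exact: continuous_sin_pi|exact: exprn_continuous].
have iX m (c : R) : mu.-integrable D (EFin \o (fun t => c * sin (pi * t) ^+ m)).
  apply: continuous_compact_integrable; first exact: segment_compact.
  by apply: continuous_subspaceT; exact: csX.
have ftc : (\int[mu]_(t in D) (pi * (n.+1%:R * sin (pi * t) ^+ n - n.+2%:R * sin (pi * t) ^+ n.+2))%:E = 0)%E.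
  have derF t : derivable (F n) t 1 by case: (dF n t).
  have contF : continuous (F n).
    by move=> t; apply: differentiable_continuous; exact/derivable1_diffP.
  rewrite (@continuous_FTC2 _ _ (F n) 0 1 ltr01).
  - by rewrite /F !mulr0 mulr1 sin0 sinpi !expr0n/= !mul0r subee.
  - apply: continuous_subspaceT => t; apply: cvgM; first exact: cvg_cst.
    by apply: cvgB; exact: csX.
  - split => //.
    + exact/cvg_at_right_filter/contF.
    + exact/cvg_at_left_filter/contF.
  - by move=> t _; rewrite derive1E; case: (dF n t).
have s0 t : D t -> 0 <= sin (pi * t) by rewrite /= in_itv/=; exact: sin_pi_ge0.
have msX m : measurable_fun D (fun t : R => (sin (pi * t) ^+ m)%:E).
  apply/measurable_EFinP/measurable_funTS.
  by apply: measurable_funX; exact: measurable_sin_pi.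
have scale (m k : nat) : (\int[mu]_(t in D) (k%:R * sin (pi * t) ^+ m)%:E =
    k%:R%:E * \int[mu]_(t in D) (sin (pi * t) ^+ m)%:E)%E.
  rewrite -ge0_integralZl//=; last by move=> t tD; rewrite lee_fin exprn_ge0// s0.
  exact: msX.
have pi0 := @pi_gt0 R.
have : (pi%:E * (\int[mu]_(t in D) (n.+1%:R * sin (pi * t) ^+ n)%:E -
    \int[mu]_(t in D) (n.+2%:R * sin (pi * t) ^+ n.+2)%:E) = 0)%E.
  rewrite -integralB_EFin// -integralZl//.
    by apply: integrableB => //; exact: iX.
have fin (m k : nat) : (\int[mu]_(t in D) (k%:R * sin (pi * t) ^+ m)%:E)%E \is a fin_num.
  by apply: integrable_fin_num => //; exact: iX.
have E1 := fineK (fin n n.+1).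
have E2 := fineK (fin n.+2 n.+2).
rewrite -E1 -E2 -EFinB -EFinM => -[] /eqP; rewrite mulf_eq0 gt_eqF//= subr_eq0 => /eqP E.
have {}E : (\int[mu]_(t in D) (n.+1%:R * sin (pi * t) ^+ n)%:E =
  \int[mu]_(t in D) (n.+2%:R * sin (pi * t) ^+ n.+2)%:E)%E.
  by rewrite -E1 -E2 E.
by rewrite -!scale E.
Qed.

Lemma integral_sin_even n :
  (\int[mu]_(t in D) (sin (pi * t) ^+ (2 * n))%:E = (wallis n)%:E)%E.
Proof.
elim: n => [|n IH].
  rewrite /wallis /pochhammer big_ord0 fact0 divr1 -[RHS]integral_cst01.
  by apply: eq_integral => t _; rewrite muln0 expr0.
rewrite mulnS; have := integral_sin_rec (2 * n); rewrite IH -EFinM => E.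
have n0 : 0 <= n%:R :> R by [].
have nE : (2 * n).+2%:R = 2 * n%:R + 2 :> R by rewrite -addn2 natrD natrM.
have nE1 : (2 * n).+1%:R = 2 * n%:R + 1 :> R by rewrite -addn1 natrD natrM.
rewrite wallisS mulrAC EFinM -nE -nE1 -E muleC muleA -EFinM mulVf ?mul1e//.
Qed.

(** Termwise integration yields extended real sums, while [hyp2F1] is a limit of real partial
    sums. *)
Lemma nneseries_EFin_limn (u : nat -> R) (S : R) : (forall n, 0 <= u n) ->
  (\sum_(0 <= n <oo) (u n)%:E = S%:E)%E -> limn (series u) = S.
Proof.
move=> u0 uS; apply/cvg_lim => //.
have := @is_cvg_nneseries R (fun n => (u n)%:E) xpredT 0 (fun n _ _ => u0 n).
rewrite /= uS => /fine_cvg; apply: cvg_trans; apply: near_eq_cvg; apply: nearW => n /=.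
by rewrite sumEFin.
Qed.

Lemma nneseries_geometric (x : R) : 0 <= x < 1 ->
  (\sum_(0 <= n <oo) (x ^+ n)%:E = ((1 - x)^-1)%:E)%E.
Proof.
move=> /andP[x0 x1]; apply/cvg_lim => //.
have := @cvg_geometric_series R 1 x; rewrite ger0_norm// mul1r => /(_ x1) c.
rewrite (_ : (fun n => _) = EFin \o series (geometric 1 x)); last first.
  apply/funext => n /=; rewrite sumEFin; congr EFin.
  by apply: eq_bigr => i _; rewrite /= mul1r.
by apply: cvg_EFin => //; exact: nearW.
Qed.

Let sin2_lt1 (y t : R) : 0 <= y < 1 -> 0 <= y * sin (pi * t) ^+ 2 < 1.
Proof.
move=> /andP[y0 y1]; rewrite mulr_ge0 ?sqr_ge0//=.
apply: le_lt_trans y1; rewrite ler_piMr//.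
Qed.

(** Averaging over z = y sin^2(pi t) multiplies the n-th coefficient by [wallis n]. Used twice:
    constant coefficients become [wallis n], and these become the squares that occur in 2F1. *)
Lemma integral_power_series_sin2 (c : nat -> R) (g : R -> R) (y : R) :
  0 <= y < 1 -> (forall n, 0 <= c n) ->
  (forall z : R, 0 <= z < 1 -> (\sum_(0 <= n <oo) (c n * z ^+ n)%:E)%E = (g z)%:E) ->
  (\sum_(0 <= n <oo) (c n * wallis n * y ^+ n)%:E =
   \int[mu]_(t in D) (g (y * sin (pi * t) ^+ 2))%:E)%E.
Proof.
move=> y01 c0 cg; have /andP[y0 y1] := y01.
have ms n : measurable_fun D (fun t : R => (sin (pi * t) ^+ (2 * n))%:E).
  apply/measurable_EFinP/measurable_funTS.
  by apply: measurable_funX; exact: measurable_sin_pi.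
transitivity (\int[mu]_(t in D) \sum_(0 <= n <oo) (c n * (y * sin (pi * t) ^+ 2) ^+ n)%:E)%E; last first.
  by apply: eq_integral => t _; rewrite cg// sin2_lt1.
rewrite integral_nneseries//.
- apply: eq_eseriesr => n _.
  transitivity (\int[mu]_(t in D) ((c n * y ^+ n)%:E * (sin (pi * t) ^+ (2 * n))%:E))%E; last first.
    by apply: eq_integral => t _; rewrite -EFinM exprMn exprM; congr EFin; ring.
  rewrite ge0_integralZl//.
  + by rewrite integral_sin_even -EFinM; congr EFin; ring.
  + exact: ms.
  + by move=> t _; rewrite lee_fin exprM exprn_ge0// sqr_ge0.
  + by rewrite lee_fin mulr_ge0// exprn_ge0.
- move=> n; apply/measurable_EFinP/measurable_funTS.
  apply: measurable_funM => //; apply: measurable_funX; apply: measurable_funM => //.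
  by apply: measurable_funX; exact: measurable_sin_pi.
- by move=> n t _; rewrite lee_fin mulr_ge0// exprn_ge0//; have /andP[] := sin2_lt1 y t y01.
Qed.

Lemma wallis_series (y : R) : 0 <= y < 1 ->
  (\sum_(0 <= n <oo) (wallis n * y ^+ n)%:E = ((Num.sqrt (1 - y))^-1)%:E)%E.
Proof.
move=> y01; rewrite -sin_kernel_integral//.
rewrite -(@integral_power_series_sin2 (fun=> 1) (fun z => (1 - z)^-1))//.
- by apply: eq_eseriesr => n _; rewrite mul1r.
- by move=> z z01; rewrite -nneseries_geometric//; apply: eq_eseriesr => n _; rewrite mul1r.
Qed.

Lemma pochhammer1 n : pochhammer (1 : R) n = n`!%:R.
Proof.
rewrite /pochhammer; elim: n => [|n IH]; first by rewrite big_ord0.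
by rewrite big_ord_recr/= IH factS natrM mulrC -natr1 addrC.
Qed.

Lemma hyp2F1_integral (m : R) : 0 <= m < 1 ->
  ((hyp2F1 (1 / 2) (1 / 2) 1 m)%:E =
   \int[mu]_(t in D) ((Num.sqrt (1 - m * sin (pi * t) ^+ 2))^-1)%:E)%E.
Proof.
move=> m01; have /andP[m0 m1] := m01.
have s1m : 0 < Num.sqrt (1 - m) by rewrite sqrtr_gt0; lra.
set I := (RHS).
(* The lower parameter 1 contributes a second factorial, one for each [wallis n]. *)
have cE n : hyp2F1_coeff (1 / 2) (1 / 2) 1 m n = wallis n * wallis n * m ^+ n.
  rewrite /hyp2F1_coeff pochhammer1 /wallis; field.
  by rewrite pnatr_eq0 -lt0n fact_gt0.
have SI : (\sum_(0 <= n <oo) (wallis n * wallis n * m ^+ n)%:E = I)%E.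
  apply: (@integral_power_series_sin2 wallis (fun z => (Num.sqrt (1 - z))^-1)) => //.
  - exact: wallis_ge0.
  - exact: wallis_series.
have I0 : (0 <= I)%E by apply: integral_ge0 => t _; rewrite lee_fin invr_ge0 sqrtr_ge0.
(* Finiteness of [I] is needed to read the extended sum as a convergent real series. *)
have Ile : (I <= ((Num.sqrt (1 - m))^-1)%:E)%E.
  rewrite -integral_cst01; apply: ge0_le_integral => //.
  - apply/measurable_EFinP/measurable_funTS; apply: (measurableT_comp measurable_invr).
    apply: (@measurableT_comp _ _ _ _ _ _ (@Num.sqrt R)).
      by apply: continuous_measurable_fun; exact: sqrt_continuous.
    apply: measurable_funB => //; apply: measurable_funM => //.
    by apply: measurable_funX; exact: measurable_sin_pi.
  - move=> t _; rewrite lee_fin; have /andP[h0 h1] := sin2_lt1 m t m01.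
    rewrite lef_pV2 ?posrE ?sqrtr_gt0; [|lra|lra].
    apply: ler_wsqrtr; rewrite lerD2l lerN2 ler_piMr//.
have If : I \is a fin_num by rewrite ge0_fin_numE// (le_lt_trans Ile)// ltry.
rewrite -(fineK If); congr EFin.
rewrite /hyp2F1 (_ : hyp2F1_coeff _ _ _ _ = fun n => wallis n * wallis n * m ^+ n); last exact/funext.
apply: nneseries_EFin_limn; last by rewrite SI fineK.
by move=> n; apply: mulr_ge0; [apply: mulr_ge0; exact: wallis_ge0|exact: exprn_ge0].
Qed.

End wallis.

(** * Tonelli on rectangles and substitution on open intervals *)

Section tonelli.
Context d1 d2 (T1 : measurableType d1) (T2 : measurableType d2) (R : realType).
Variables (m1 : {sigma_finite_measure set T1 -> \bar R})
  (m2 : {sigma_finite_measure set T2 -> \bar R}).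
Variables (A : set T1) (B : set T2) (f : T1 * T2 -> \bar R).
Hypotheses (mA : measurable A) (mB : measurable B).
Hypotheses (mf : measurable_fun setT f) (f0 : forall z, (0 <= f z)%E).

(** Extension by zero moves the integrals to the whole spaces, where Tonelli's theorem is
    applied. *)
Let fr := f \_ (A `*` B).

Let mfr : measurable_fun setT fr.
Proof.
apply/(measurable_restrictT _ _).1; first exact: measurableX.
exact: measurable_funTS.
Qed.

Let fr0 z : (0 <= fr z)%E.
Proof. exact: erestrict_ge0. Qed.

Let frE x y : fr (x, y) = ((fun y => ((fun x => f (x, y)) \_ A) x) \_ B) y.
Proof.
rewrite /fr /patch in_setX/=.
by case: (x \in A); case: (y \in B).
Qed.

Let integral_frl y : (\int[m1]_x fr (x, y) = ((fun y => \int[m1]_(x in A) f (x, y)) \_ B) y)%E.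
Proof.
under eq_integral do rewrite frE.
rewrite /patch; case: ifPn => yB; last exact: integral0.
by rewrite [RHS]integral_mkcond.
Qed.

Let integral_frr x : (\int[m2]_y fr (x, y) = ((fun x => \int[m2]_(y in B) f (x, y)) \_ A) x)%E.
Proof.
under eq_integral do rewrite frE.
rewrite /patch; case: ifPn => xA; first by rewrite [RHS]integral_mkcond.
by apply: integral0_eq => y _; case: ifPn.
Qed.

Lemma integral_setX_tonelli :
  (\int[m1 \x m2]_(z in A `*` B) f z = \int[m2]_(y in B) \int[m1]_(x in A) f (x, y))%E.
Proof.
rewrite integral_mkcond [RHS]integral_mkcond fubini_tonelli2//.
by apply: eq_integral => y _; exact: integral_frl.
Qed.

Lemma integral_tonelli_swap :
  (\int[m1]_(x in A) \int[m2]_(y in B) f (x, y) = \int[m2]_(y in B) \int[m1]_(x in A) f (x, y))%E.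
Proof.
rewrite integral_mkcond [RHS]integral_mkcond.
transitivity (\int[m1]_x \int[m2]_y fr (x, y))%E.
  by apply: eq_integral => x _; rewrite integral_frr.
rewrite fubini_tonelli//.
by apply: eq_integral => y _; rewrite integral_frl.
Qed.

End tonelli.

Lemma measurable_fun_integral_section d1 d2 (T1 : measurableType d1) (T2 : measurableType d2)
    (R : realType) (m1 : {sigma_finite_measure set T1 -> \bar R}) (A : set T1)
    (f : T1 * T2 -> \bar R) : measurable A -> measurable_fun setT f ->
  (forall z, (0 <= f z)%E) ->
  measurable_fun setT (fun y => \int[m1]_(x in A) f (x, y))%E.
Proof.
move=> mA mf f0.
have mfr : measurable_fun setT (f \_ (A `*` setT)).
  by apply/(measurable_restrictT _ _).1; [exact: measurableX|exact: measurable_funTS].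
have fr0 z : (0 <= (f \_ (A `*` setT)) z)%E by exact: erestrict_ge0.
have := @measurable_fun_fubini_tonelli_G _ _ _ _ _ m1 _ mfr fr0.
apply: eq_measurable_fun => y _; rewrite /fubini_G [RHS]integral_mkcond.
by apply: eq_integral => x _; rewrite /patch in_setX in_setT andbT.
Qed.

(** * Reflections, quarter periods, and substitution with singular endpoints *)

Section substitution.
Context {R : realType}.
Notation mu := (@lebesgue_measure R).
Local Notation D := (`[0%R, 1%R]%classic : set R).
Local Notation H := (`]0%R, 1 / 2[%classic : set R).

Lemma ge0_integral_reflect (c : R) (f : R -> \bar R) :
  measurable_fun setT f -> (forall x, 0 <= f x)%E ->
  (\int[mu]_x f (c - x)%R = \int[mu]_x f x)%E.
Proof.
move=> mf f0.
have -> : (\int[mu]_x f (c - x)%R = \int[mu]_x f (c + x)%R)%E.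
  apply: (@ge0_integral_opp _ (fun x => f (c + x)%R)) => //.
  by apply: measurableT_comp => //; exact: measurable_funD.
have := @ge0_integral_affine R 1 c f ltr01 mf f0.
rewrite invr1 mul1e => <-.
by apply: eq_integral => x _; rewrite mul1r addrC.
Qed.

Lemma ge0_integral_reflect_itv (c x y : R) (f : R -> \bar R) :
  measurable_fun setT f -> (forall x, 0 <= f x)%E ->
  (\int[mu]_(t in `]x, y[) f (c - t)%R = \int[mu]_(t in `](c - y)%R, (c - x)%R[) f t)%E.
Proof.
move=> mf f0; rewrite integral_mkcond [RHS]integral_mkcond -[RHS](ge0_integral_reflect c).
- apply: eq_integral => t _; rewrite /patch !mem_setE !in_itv/=.
  by rewrite ltrD2l ltrN2 ltrD2l ltrN2 andbC.
- by apply/(measurable_restrictT _ _).1 => //; exact: measurable_funTS.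
- by move=> t; exact: erestrict_ge0.
Qed.

(** Symmetry about [1 / 2]. On [H] the sine is positive and increasing, hence fit for a change of
    variables. *)
Lemma ge0_integral_abs_sin (k : R -> \bar R) :
  measurable_fun setT k -> (forall x, 0 <= k x)%E ->
  (\int[mu]_(t in D) k `|sin (pi * t)|%R = 2%:E * \int[mu]_(t in H) k (sin (pi * t)))%E.
Proof.
move=> mk k0.
have mks : measurable_fun setT (fun t : R => k `|sin (pi * t)|%R).
  by do 2 apply: measurableT_comp => //; exact: measurable_sin_pi.
have mks' : measurable_fun setT (fun t : R => k (sin (pi * t))).
  by apply: measurableT_comp => //; exact: measurable_sin_pi.
rewrite integral_itv_cc_co// (@ge0_integral_itv_split _ 0 (1 / 2) 1)//; last lra.
have oo (x y : R) : (\int[mu]_(t in `[x, y[) k `|sin (pi * t)|%R =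
    \int[mu]_(t in `]x, y[) k `|sin (pi * t)|%R)%E.
  by apply: integral_itv_bndoo; exact: measurable_funTS.
rewrite !oo.
have pi0 := @pi_gt0 R.
have E1 : (\int[mu]_(t in H) k `|sin (pi * t)|%R = \int[mu]_(t in H) k (sin (pi * t)))%E.
  apply: eq_integral => t /set_mem/=; rewrite in_itv/= => /andP[t0 t1].
  by rewrite ger0_norm// sin_pi_ge0//; apply/andP; split; lra.
have -> : (\int[mu]_(t in `](1 / 2)%R, 1%R[) k `|sin (pi * t)|%R = \int[mu]_(t in H) k `|sin (pi * t)|%R)%E.
  have := @ge0_integral_reflect_itv 1 0 (1 / 2) _ mks (fun=> k0 _).
  rewrite subr0 (_ : 1 - 1 / 2 = 1 / 2 :> R); last by field.
  move=> <-; apply: eq_integral => t _.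
  by rewrite mulrBr mulr1 addrC sinDpi sinN opprK.
by rewrite !E1 mule_natl mule2n.
Qed.

Lemma ge0_integral_abs_cos (k : R -> \bar R) :
  measurable_fun setT k -> (forall x, 0 <= k x)%E ->
  (\int[mu]_(t in D) k `|cos (pi * t)|%R = 2%:E * \int[mu]_(t in H) k (sin (pi * t)))%E.
Proof.
move=> mk k0; rewrite -ge0_integral_abs_sin//.
rewrite -(@ge0_integral_periodic_shift _ (1 / 2) (fun t : R => k `|sin (pi * t)|%R))//.
- apply: eq_integral => t _; rewrite mulrDr (_ : pi * (1 / 2) = pi / 2); last by field.
  by rewrite sinDpihalf.
- by apply/andP; split; lra.
- by do 2 apply: measurableT_comp => //; exact: measurable_sin_pi.
- by move=> t; rewrite mulrDr mulr1 sinDpi normrN.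
Qed.

(** [G] may blow up at the ends, as inverse square roots do. Substitution is therefore made on
    compact subintervals, and nonnegativity allows both open intervals to be exhausted
    monotonically. *)
Lemma ge0_integration_by_substitution_oo (F f G : R -> R) (a b : R) : a < b ->
  continuous F ->
  (forall x, a < x < b -> is_derive x 1 F (f x)) ->
  (forall x, a < x < b -> 0 < f x) ->
  (forall x, a < x < b -> {for x, continuous f}) ->
  (forall x, F a < x < F b -> {for x, continuous G}) ->
  (forall x, F a < x < F b -> 0 <= G x) ->
  (\int[mu]_(x in `]F a, F b[) (G x)%:E = \int[mu]_(x in `]a, b[) (G (F x) * f x)%:E)%E.
Proof.
move=> ab cF dF f0 cf cG G0.
have DE x : a < x < b -> F^`() x = f x by move=> xab; rewrite derive1E; case: (dF x xab).
have Fmono x y : a <= x -> x < y -> y <= b -> F x < F y.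
  apply: (@gtr0_derive1_incr _ F a b).
  - by move=> z; rewrite in_itv/= => /dF[].
  - by move=> z; rewrite in_itv/= => zab; rewrite DE// f0.
  - exact: continuous_subspaceT.
have cDF x : a < x < b -> {for x, continuous F^`()}.
  move=> xab; rewrite /prop_for /continuous_at DE//.
  apply: cvg_trans (cf x xab); apply: near_eq_cvg.
  have : x \in `]a, b[%R by rewrite in_itv/=.
  move=> /near_in_itvoo; apply: filterS => y; rewrite in_itv/= => yab.
  by rewrite DE.
(* The offset 3 keeps 2 [e n] below b - a from n = 0 on, so no subinterval degenerates. *)
pose e n : R := (b - a) / n.+3%:R.
have e0 n : 0 < e n by rewrite divr_gt0 ?subr_gt0.
have eab n : e n * 2 < b - a.
  rewrite /e mulrAC ltr_pdivrMr// ltr_pM2l ?subr_gt0// ltr_nat; by [].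
have en n m : (n <= m)%N -> e m <= e n.
  by move=> nm; rewrite ler_pM2l ?subr_gt0// lef_pV2 ?posrE// ler_nat.
have ecvg : e @ \oo --> (0 : R).
  rewrite -(mulr0 (b - a)); apply: cvgM; first exact: cvg_cst.
  by have := @cvg_harmonic R; rewrite -cvg_shiftS -cvg_shiftS.
pose al n := a + e n; pose be n := b - e n.
have aal n : a < al n by rewrite ltrDl.
have beb n : be n < b by rewrite gtrBl.
have albe n : al n < be n by rewrite /al /be; have := eab n; lra.
have inab n x : al n <= x <= be n -> a < x < b.
  by move=> /andP[h1 h2]; rewrite (lt_le_trans (aal n) h1) (le_lt_trans h2 (beb n)).
have FaF x : a < x < b -> F a < F x < F b.
  by move=> /andP[ax xb]; rewrite !Fmono ?lexx// ltW.
have inF n y : F (al n) <= y <= F (be n) -> F a < y < F b.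
  move=> /andP[h1 h2].
  have /andP[l1 _] : F a < F (al n) < F b by apply/FaF/(inab n); rewrite lexx ltW.
  have /andP[_ l2] : F a < F (be n) < F b by apply/FaF/(inab n); rewrite lexx ltW.
  by rewrite (lt_le_trans l1 h1) (le_lt_trans h2 l2).
have sub n : (\int[mu]_(x in `[F (al n), F (be n)]) (G x)%:E =
    \int[mu]_(x in `[al n, be n]) (G (F x) * f x)%:E)%E.
  rewrite (@integration_by_substitution_increasing _ F G (al n) (be n)) ?ltW//.
  - apply: eq_integral => x /set_mem/=; rewrite in_itv/= => xn.
    by congr EFin; rewrite -DE// (inab n).
  - move=> x y; rewrite !in_itv/= => /inab/andP[ax _] /inab/andP[_ yb] xy.
    by rewrite Fmono// ltW.
  - move=> x; rewrite in_itv/= => /andP[h1 h2]; apply: cDF; apply: (inab n).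
    by rewrite !ltW.
  - apply/cvg_ex; exists (F^`() (al n)); apply: cvg_at_right_filter; apply: cDF.
    by apply: (inab n); rewrite lexx ltW.
  - apply/cvg_ex; exists (F^`() (be n)); apply: cvg_at_left_filter; apply: cDF.
    by apply: (inab n); rewrite lexx ltW.
  - split.
    + move=> x; rewrite in_itv/= => /andP[h1 h2].
      by have [] := dF x (inab n x _); rewrite ?ltW.
    + by apply: cvg_at_right_filter; exact: cF.
    + by apply: cvg_at_left_filter; exact: cF.
  - apply: continuous_in_subspaceT => y /set_mem/=; rewrite in_itv/= => /inF.
    exact: cG.
have bigcup_ab : \bigcup_n `[al n, be n] = `]a, b[%classic.
  apply/seteqP; split => [x [n _] /=|x /=]; rewrite !in_itv/=; first exact: inab.
  move=> /andP[ax xb].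
  have : \forall n \near \oo, e n < Num.min (x - a) (b - x).
    by apply: (cvgr_lt _ ecvg); rewrite lt_min !subr_gt0 ax.
  move=> [N _ /(_ N (leqnn N))]/=; rewrite lt_min => /andP[h1 h2].
  by exists N => //=; rewrite in_itv/= /al /be; apply/andP; split; lra.
have bigcup_F : \bigcup_n `[F (al n), F (be n)] = `]F a, F b[%classic.
  apply/seteqP; split => [x [n _] /=|x /=]; rewrite !in_itv/=; first exact: inF.
  move=> /andP[ax xb].
  have c1 : F (al n) @[n --> \oo] --> F a.
    apply: (@continuous_cvg _ _ _ _ _ al F); first exact: cF.
    by rewrite -[X in _ --> X]addr0; apply: cvgD => //; exact: cvg_cst.
  have c2 : F (be n) @[n --> \oo] --> F b.
    apply: (@continuous_cvg _ _ _ _ _ be F); first exact: cF.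
    by rewrite -[X in _ --> X]subr0; apply: cvgB => //; exact: cvg_cst.
  have : \forall n \near \oo, F (al n) < x /\ x < F (be n).
    by apply: filterI; [exact: (cvgr_lt _ c1)|exact: (cvgr_gt _ c2)].
  move=> [N _ /(_ N (leqnn N))]/= [h1 h2].
  by exists N => //=; rewrite in_itv/= !ltW.
have L : (\int[mu]_(x in `[F (al n), F (be n)]) (G x)%:E)%E @[n --> \oo] -->
    (\int[mu]_(x in `]F a, F b[) (G x)%:E)%E.
  rewrite -bigcup_F; apply: ge0_nondecreasing_set_cvg_integral => //.
  - move=> n m nm; apply/subsetPset => y /=; rewrite !in_itv/= => /andP[h1 h2].
    have := en _ _ nm => enm.
    have F1 : F (al m) <= F (al n).
      have : al m <= al n by rewrite lerD2l.
      rewrite le_eqVlt => /predU1P[->//|lt]; apply/ltW/Fmono => //; first exact/ltW.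
      by apply/ltW/(lt_trans (albe n)).
    have F2 : F (be n) <= F (be m).
      have : be n <= be m by rewrite lerD2l lerN2.
      rewrite le_eqVlt => /predU1P[->//|lt]; apply/ltW/Fmono => //; last exact/ltW.
      by apply/ltW/(lt_trans (aal n)).
    by rewrite (le_trans F1 h1) (le_trans h2 F2).
  - move=> n; apply/measurable_EFinP; apply: subspace_continuous_measurable_fun => //.
    apply: continuous_in_subspaceT => y /set_mem/=; rewrite in_itv/= => /inF.
    exact: cG.
  - by move=> n x /=; rewrite in_itv/= => /inF xF; rewrite lee_fin G0.
have L' : (\int[mu]_(x in `[al n, be n]) (G (F x) * f x)%:E)%E @[n --> \oo] -->
    (\int[mu]_(x in `]a, b[) (G (F x) * f x)%:E)%E.
  rewrite -bigcup_ab; apply: ge0_nondecreasing_set_cvg_integral => //.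
  - move=> n m nm; apply/subsetPset => y /=; rewrite !in_itv/= => /andP[h1 h2].
    by have := en _ _ nm; rewrite /al /be in h1 h2 *; move=> enm; apply/andP; split; lra.
  - move=> n; apply/measurable_EFinP; apply: subspace_continuous_measurable_fun => //.
    apply: continuous_in_subspaceT => x /set_mem/=; rewrite in_itv/= => /inab xab.
    apply: cvgM; last exact: cf.
    apply: (@continuous_cvg _ _ _ _ _ F G); last exact: cF.
    by apply: cG; exact: FaF.
  - by move=> n x /=; rewrite in_itv/= => /inab xab; rewrite lee_fin mulr_ge0 ?G0 ?FaF// ltW ?f0.
move: L; under eq_fun do rewrite sub; move=> L.
exact: (cvg_unique _ L L').
Qed.

End substitution.

(** * The Mahler measure as a mean over two circles *)

Section mahler.
Context {R : realType}.
Notation mu := (@lebesgue_measure R).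
Local Notation D := (`[0%R, 1%R]%classic : set R).
Local Notation T := (measurableTypeR R).

Definition ln_minus (x : R) : R := Num.max 0 (- ln x).

Lemma ln_minus_ge0 (x : R) : 0 <= ln_minus x.
Proof. by rewrite le_max lexx. Qed.

Lemma ln_plus_minus (r : R) : ln_plus r - ln_minus `|r| = ln `|r|.
Proof.
rewrite /ln_minus; have [r1|r1] := leP `|r| 1.
  by rewrite ln_plus_le1// max_r ?oppr_ge0 ?ln_le0// sub0r opprK.
by rewrite ln_plus_ge1 ?ltW// max_l ?subr0// oppr_le0 ln_ge0 ?ltW.
Qed.

Lemma measurable_ln_minus : measurable_fun setT ln_minus.
Proof.
apply: measurable_maxr => //; apply: measurable_funN; exact: measurable_ln.
Qed.

(* Up to a unit, (1 + x2) (1 + x3) at x2 = exp (2 pi i b), x3 = exp (2 pi i c);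
   it may be negative. *)
Definition prod_cos (b c : R) : R := 4 * cos (pi * b) * cos (pi * c).

Lemma prod_cos_le4 (b c : R) : `|prod_cos b c| <= 4.
Proof.
rewrite /prod_cos !normrM (@ger0_norm _ 4)//.
have le1 x : `|cos x| <= 1 :> R by rewrite ler_norml cos_geN1 cos_le1.
by rewrite -mulrA ler_piMr// mulr_ile1.
Qed.

Lemma ln_le_ln5 (r : R) : `|r| <= 4 -> 2 * ln (1 + `|r|) <= 2 * ln 5.
Proof.
rewrite ler_pM2l// ler_ln ?posrE; have := normr_ge0 r; lra.
Qed.

(** Halving passes from the squared modulus to the modulus, which is at most 1 + 4. *)
Lemma jensen_half (r s : R) : 0 <= s <= 1 -> `|r| <= 4 ->
  (\int[mu]_(t in D) (ln 5 - ln (circ_norm2 r (t + s)) / 2)%:E = (ln 5 - ln_plus r)%:E)%E.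
Proof.
move=> s01 r4.
transitivity (\int[mu]_(t in D) ((1 / 2)%:E * (2 * ln 5 - ln (circ_norm2 r (t + s)))%:E))%E.
  by apply: eq_integral => t _; rewrite -EFinM; congr EFin; field.
rewrite ge0_integralZl//.
- by rewrite jensen ?ln_le_ln5// -EFinM; congr EFin; field.
- apply/measurable_EFinP/measurable_funTS; apply: measurable_funB => //.
  apply: (@measurableT_comp _ _ _ _ _ _ (@ln R)); first exact: measurable_ln.
  by apply: (measurableT_comp (measurable_circ_norm2 r)); exact: measurable_funD.
- by move=> t _; rewrite lee_fin subr_ge0 (le_trans (ln_circ_norm2_le_abs _ _))// ln_le_ln5.
Qed.

Lemma jensen_cos (C : R) : ln 2 <= C ->
  (\int[mu]_(t in D) (C - ln (circ_norm2 1 t) / 2)%:E = C%:E)%E.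
Proof.
move=> C2.
have le t : ln (circ_norm2 (1 : R) t) <= 2 * ln 2.
  by have := @ln_circ_norm2_le R 1 t ler01; rewrite (_ : 1 + 1 = 2 :> R)//.
transitivity (\int[mu]_(t in D) ((1 / 2)%:E * (2 * C - ln (circ_norm2 1 t))%:E))%E.
  by apply: eq_integral => t _; rewrite -EFinM; congr EFin; field.
rewrite ge0_integralZl//.
- rewrite jensen_ge0// ?ln_plus_le1 ?normr1//; last by rewrite ler_pM2l.
  by rewrite -EFinM; congr EFin; field.
- apply/measurable_EFinP/measurable_funTS; apply: measurable_funB => //.
  apply: (@measurableT_comp _ _ _ _ _ _ (@ln R)); first exact: measurable_ln.
  exact: measurable_circ_norm2.
- move=> t _; rewrite lee_fin subr_ge0; have := le t; lra.
Qed.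

Lemma circ_norm2_ge0 (r s : R) : 0 <= circ_norm2 r s.
Proof.
rewrite /circ_norm2; have := cos_geN1 (2 * pi * s); have := cos_le1 (2 * pi * s).
move: (cos _) => c c1 cN1.
have -> : 1 + r ^+ 2 + 2 * r * c = (r + c) ^+ 2 + (1 - c) * (1 + c) by ring.
by rewrite addr_ge0 ?sqr_ge0// mulr_ge0//; lra.
Qed.

Lemma measurable_cos_pi_fst : measurable_fun setT (fun z : T * T => cos (pi * z.1) : R).
Proof. exact: (measurableT_comp measurable_cos_pi (@measurable_fst _ _ T T)). Qed.

Lemma measurable_cos_pi_snd : measurable_fun setT (fun z : T * T => cos (pi * z.2) : R).
Proof. exact: (measurableT_comp measurable_cos_pi (@measurable_snd _ _ T T)). Qed.

Lemma measurable_prod_cos : measurable_fun setT (fun z : T * T => prod_cos z.1 z.2).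
Proof.
apply: measurable_funM; last exact: measurable_cos_pi_snd.
by apply: measurable_funM => //; exact: measurable_cos_pi_fst.
Qed.

(** The mean of log |1 + x| vanishes in each of the two variables, so only the constant survives. *)
Lemma integral_ln_prod_cos :
  (\int[mu]_(c in D) \int[mu]_(b in D) (ln 5 - ln `|prod_cos b c|)%:E = (ln 5)%:E)%E.
Proof.
have lnE (x : R) : ln `|x| = ln (x ^+ 2) / 2 by rewrite -ln_sqrt ?sqr_ge0// sqrtr_sqr.
have mf : measurable_fun setT (fun z : T * T => (ln 5 - ln `|prod_cos z.1 z.2|)%:E).
  apply/measurable_EFinP; apply: measurable_funB => //.
  apply: (@measurableT_comp _ _ _ _ _ _ (@ln R)); first exact: measurable_ln.
  by apply: measurableT_comp => //; exact: measurable_prod_cos.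
have ln25 : 2 * ln 2 <= ln 5 :> R.
  by rewrite mulr_natl -lnXn// ler_ln ?posrE ?exprn_gt0//; lra.
have ln2_0 : 0 <= ln 2 :> R by apply: ln_ge0; lra.
have f0 (z : T * T) : (0 <= (ln 5 - ln `|prod_cos z.1 z.2|)%:E)%E.
  rewrite lee_fin subr_ge0; have [p0|p0] := ltP 0 `|prod_cos z.1 z.2|.
    by rewrite ler_ln ?posrE// (le_trans (prod_cos_le4 _ _))//; lra.
  by rewrite ln0//; lra.
rewrite -integral_setD1_half; last exact: (@measurable_fun_integral_section _ _ T T R mu D _ (measurable_itv _) mf f0).
have le t : ln (circ_norm2 (1 : R) t) <= 2 * ln 2.
  by have := @ln_circ_norm2_le R 1 t ler01; rewrite (_ : 1 + 1 = 2 :> R)//.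
have mcirc (C : R) : measurable_fun setT (fun t : R => (C - ln (circ_norm2 1 t) / 2)%:E).
  apply/measurable_EFinP; apply: measurable_funB => //; apply: measurable_funM => //.
  apply: (@measurableT_comp _ _ _ _ _ _ (@ln R)); first exact: measurable_ln.
  exact: measurable_circ_norm2.
transitivity (\int[mu]_(c in D `\ (1 / 2)%R) (ln 5 - ln (circ_norm2 1 c) / 2)%:E)%E; last first.
  by rewrite integral_setD1_half// jensen_cos//; lra.
apply: eq_integral => c /set_mem cD.
rewrite -integral_setD1_half; last exact: (measurableT_comp mf (@measurable_pair2 _ _ T T c)).
(* For fixed [c] the logarithm of its factor joins the constant; the new majorant is at least ln 5 -
   ln 2, hence at least ln 2. *)
rewrite -(@jensen_cos (ln 5 - ln (circ_norm2 1 c) / 2)); last by have := le c; lra.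
rewrite -integral_setD1_half//; apply: eq_integral => b /set_mem bD.
congr EFin; rewrite lnE.
have -> : prod_cos b c ^+ 2 = circ_norm2 1 b * circ_norm2 1 c.
  by rewrite !circ_norm2_1 /prod_cos; ring.
by rewrite lnM ?posrE ?circ_norm2_1_gt0//; field.
Qed.

(* The sigma-finite structure that the library puts on product measures is
   shadowed by the one for products of subprobabilities, hence not inferred. *)
Lemma sigma_finite_lebesgue2 : sigma_finite setT (mu \x mu)%E.
Proof.
pose F n : set T := `[- n%:R, n%:R]%classic.
exists (fun n => F n `*` F n).
  apply/esym; rewrite -subTset => -[x y] _.
  have b (z : R) n : (Num.bound z <= n)%N -> (Num.bound (- z) <= n)%N -> F n z.
    move=> h1 h2; rewrite /F/= in_itv/= lerNl; apply/andP; split.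
      by apply: ltW (lt_le_trans (unstable.ltr_bound _) _); rewrite ler_nat.
    by apply: ltW (lt_le_trans (unstable.ltr_bound _) _); rewrite ler_nat.
  exists (maxn (maxn (Num.bound x) (Num.bound (- x))) (maxn (Num.bound y) (Num.bound (- y)))) => //.
  by split; apply: b; rewrite !leq_max leqnn ?orbT.
move=> n; have mF : measurable (F n) by exact: measurable_itv.
have Foo : (mu (F n) < +oo)%E.
  by rewrite /F lebesgue_measure_itv/=; case: ifP => _; rewrite -?EFinB ltry.
split; first exact: measurableX.
by rewrite product_measure1E// lte_mul_pinfty// ge0_fin_numE.
Qed.

Definition lebesgue2 : {sigma_finite_measure set (T * T)%type -> \bar R} :=
  HB.pack (mu \x mu)%E (Measure_isSigmaFinite.Build _ _ _ (mu \x mu)%E sigma_finite_lebesgue2).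

Lemma mahler_P3_ln_minus :
  mahler_P3 R = (\int[mu]_(c in D) \int[mu]_(b in D) (ln_minus `|prod_cos b c|)%:E)%E.
Proof.
(* By [normc_P3] this is ln 5 - log |P3|, which is nonnegative. *)
pose g (z : T * T * T) : R :=
  ln 5 - ln (circ_norm2 (prod_cos z.1.2 z.2) (z.1.1 - (z.1.2 + z.2) / 2)) / 2.
have m11 : measurable_fun setT (fun z : T * T * T => z.1.1 : R).
  exact: (measurableT_comp (@measurable_fst _ _ T T) (@measurable_fst _ _ (T * T)%type T)).
have m12 : measurable_fun setT (fun z : T * T * T => z.1.2 : R).
  exact: (measurableT_comp (@measurable_snd _ _ T T) (@measurable_fst _ _ (T * T)%type T)).
have m2 : measurable_fun setT (fun z : T * T * T => z.2 : R).
  exact: (@measurable_snd _ _ (T * T)%type T).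
have mr : measurable_fun setT (fun z : T * T * T => prod_cos z.1.2 z.2).
  apply: measurable_funM; last exact: (measurableT_comp measurable_cos_pi m2).
  by apply: measurable_funM => //; exact: (measurableT_comp measurable_cos_pi m12).
have mg : measurable_fun setT (fun z => (g z)%:E).
  apply/measurable_EFinP; apply: measurable_funB => //; apply: measurable_funM => //.
  apply: (@measurableT_comp _ _ _ _ _ _ (@ln R)); first exact: measurable_ln.
  apply: measurable_funD; first by apply: measurable_funD => //; exact: measurable_funX.
  apply: measurable_funM; first exact: measurable_funM.
  apply: (@measurableT_comp _ _ _ _ _ _ (@cos R)).
    by apply: continuous_measurable_fun; exact: continuous_cos.
  apply: measurable_funM => //; apply: measurable_funB => //.
  by apply: measurable_funM => //; exact: measurable_funD.
have g0 z : (0 <= (g z)%:E)%E.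
  rewrite lee_fin subr_ge0 ler_pdivrMr// (mulrC (ln 5)) (le_trans (ln_circ_norm2_le_abs _ _))//.
  by rewrite ln_le_ln5// prod_cos_le4.
have mD : measurable (D : set T) by [].
have mDD : measurable (D `*` D : set (T * T)) by exact: measurableX.
pose A := (\int[mu]_(c in D) \int[mu]_(b in D) (ln 5 - ln_plus (prod_cos b c))%:E)%E.
pose B := (\int[mu]_(c in D) \int[mu]_(b in D) (ln_minus `|prod_cos b c|)%:E)%E.
have gA : (\int[(mu \x mu) \x mu]_(z in (D `*` D) `*` D) (g z)%:E = A)%E.
  have E3 := @integral_setX_tonelli _ _ (T * T)%type T R _ mu _ _ (fun z => (g z)%:E) mDD mD mg g0.
  rewrite (E3 lebesgue2).
  apply: eq_integral => c /set_mem/=; rewrite in_itv/= => /andP[c0 c1].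
  have mgc : measurable_fun setT (fun z : T * T => (g (z, c))%:E).
    exact: (measurableT_comp mg (@measurable_pair2 _ _ (T * T)%type T c)).
  rewrite (@integral_setX_tonelli _ _ T T R mu mu D D _ mD mD mgc (fun z => g0 (z, c))).
  apply: eq_integral => b /set_mem/=; rewrite in_itv/= => /andP[b0 b1].
  (* The phase -(b + c)/2 is raised by one period to lie in [[0, 1]]. *)
  rewrite -(@jensen_half _ (1 - (b + c) / 2)) ?prod_cos_le4//; last by apply/andP; split; lra.
  apply: eq_integral => a _; rewrite /g/=.
  rewrite (_ : a + (1 - (b + c) / 2) = a - (b + c) / 2 + 1); last by ring.
  by rewrite circ_norm2_periodic.
have mlp : measurable_fun setT (fun z : T * T => (ln 5 - ln_plus (prod_cos z.1 z.2))%:E).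
  apply/measurable_EFinP; apply: measurable_funB => //.
  apply: (@measurableT_comp _ _ _ _ _ _ (@ln R)); first exact: measurable_ln.
  by apply: measurable_maxr => //; apply: measurableT_comp => //; exact: measurable_prod_cos.
have mlm : measurable_fun setT (fun z : T * T => (ln_minus `|prod_cos z.1 z.2|)%:E).
  apply/measurable_EFinP; apply: (measurableT_comp measurable_ln_minus).
  by apply: measurableT_comp => //; exact: measurable_prod_cos.
have lp0 (z : T * T) : (0 <= (ln 5 - ln_plus (prod_cos z.1 z.2))%:E)%E.
  have m0 : 0 < Num.max 1 `|prod_cos z.1 z.2| by rewrite lt_max ltr01.
  rewrite lee_fin subr_ge0 /ln_plus ler_ln ?posrE// ge_max; apply/andP; split; first lra.
  by apply: le_trans (prod_cos_le4 _ _) _; lra.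
have lm0 (z : T * T) : (0 <= (ln_minus `|prod_cos z.1 z.2|)%:E)%E by rewrite lee_fin ln_minus_ge0.
(* The sum of the integrands is ln 5 - log |r|, and log |r| has mean 0. Thus ln 5 - A, the mean of
   log^+, equals the mean [B] of log^-. *)
have AB : (A + B = (ln 5)%:E)%E.
  have mlpc (c : R) : measurable_fun D (fun b : R => (ln 5 - ln_plus (prod_cos b c))%:E).
    by apply: measurable_funTS; exact: (measurableT_comp mlp (@measurable_pair2 _ _ T T c)).
  have mlmc (c : R) : measurable_fun D (fun b : R => (ln_minus `|prod_cos b c|)%:E).
    by apply: measurable_funTS; exact: (measurableT_comp mlm (@measurable_pair2 _ _ T T c)).
  have mlpD : measurable_fun D (fun c : R => \int[mu]_(b in D) (ln 5 - ln_plus (prod_cos b c))%:E)%E.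
    by apply: measurable_funTS; exact: (@measurable_fun_integral_section _ _ T T R mu D _ (measurable_itv _) mlp lp0).
  have mlmD : measurable_fun D (fun c : R => \int[mu]_(b in D) (ln_minus `|prod_cos b c|)%:E)%E.
    by apply: measurable_funTS; exact: (@measurable_fun_integral_section _ _ T T R mu D _ (measurable_itv _) mlm lm0).
  rewrite -integral_ln_prod_cos /A /B.
  rewrite -(@ge0_integralD _ _ _ mu D (measurable_itv _) _ _ _ mlpD _ mlmD).
  - apply: eq_integral => c _.
    rewrite -(@ge0_integralD _ _ _ mu D (measurable_itv _) _ _ _ (mlpc c) _ (mlmc c)).
    + by apply: eq_integral => b _; rewrite -EFinD -ln_plus_minus; congr EFin; ring.
    + by move=> b _; exact: (lp0 (b, c)).
    + by move=> b _; exact: (lm0 (b, c)).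
  - by move=> c _; apply: integral_ge0 => b _; exact: (lp0 (b, c)).
  - by move=> c _; apply: integral_ge0 => b _; exact: (lm0 (b, c)).
have B0 : (0 <= B)%E by apply: integral_ge0 => c _; apply: integral_ge0 => b _; rewrite lee_fin ln_minus_ge0.
have A0 : (0 <= A)%E by rewrite -gA; apply: integral_ge0.
have Af : A \is a fin_num.
  rewrite ge0_fin_numE//; apply: (@le_lt_trans _ _ (ln 5)%:E); last exact: ltry.
  by rewrite -AB; exact: leeDl.
have c5 : (\int[(mu \x mu) \x mu]_(z in (D `*` D) `*` D) (ln 5)%:E = (ln 5 : R)%:E)%E.
  have ln50 : 0 <= ln 5 :> R by apply: ln_ge0; lra.
  have C0 (d : measure_display) (X : measurableType d) (x : X) : (0 <= (ln 5 : R)%:E)%E by rewrite lee_fin.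
  have := @integral_setX_tonelli _ _ (T * T)%type T R lebesgue2 mu _ _
    (fun=> (ln 5)%:E) mDD mD (measurable_cst _) (C0 _ _).
  move=> ->; rewrite -[RHS]integral_cst01; apply: eq_integral => c _.
  have := @integral_setX_tonelli _ _ T T R mu mu D D (fun=> (ln 5)%:E) mD mD (measurable_cst _) (C0 _ _).
  by move=> ->; rewrite -[RHS]integral_cst01; apply: eq_integral => b _; exact: integral_cst01.
rewrite /mahler_P3.
transitivity (\int[(mu \x mu) \x mu]_(z in (D `*` D) `*` D) ((ln 5)%:E - (g z)%:E))%E.
  apply: eq_integral => z _; rewrite normc_P3 ln_sqrt.
    by rewrite -EFinB; congr EFin; rewrite /g /prod_cos; ring.
  exact: circ_norm2_ge0.
have mQ : measurable ((D `*` D) `*` D : set (T * T * T)) by exact: measurableX.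
have ln50 : 0 <= ln 5 :> R by apply: ln_ge0; lra.
(* Both integrals are finite, so the constant can be taken out: (A + B) - A = B. *)
rewrite integralB//.
- by rewrite c5 gA -AB (addeC A) addeK.
- apply/integrableP; split => //.
  by under eq_integral do rewrite /= ger0_norm//; rewrite c5 ltry.
- apply/integrableP; split; first exact: measurable_funTS.
  by under eq_integral do rewrite gee0_abs//; rewrite gA ltey_eq Af.
Qed.

End mahler.

(** * The density of the product of the two moduli *)

Section density.
Context {R : realType}.
Notation mu := (@lebesgue_measure R).
Local Notation D := (`[0%R, 1%R]%classic : set R).
Local Notation H := (`]0%R, 1 / 2[%classic : set R).
Local Notation T := (measurableTypeR R).

Lemma sin_pi_half : sin (pi * (1 / 2)) = 1 :> R.
Proof. by rewrite (_ : pi * (1 / 2) = pi / 2) ?sin_pihalf//; field. Qed.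

Lemma cos_pi_gt0 (t : R) : 0 < t < 1 / 2 -> 0 < cos (pi * t).
Proof.
move=> /andP[t0 t1]; have p0 := @pi_gt0 R; apply: cos_gt0_pihalf.
by apply/andP; split; nra.
Qed.

Lemma sin_pi_gt0 (t : R) : 0 < t < 1 / 2 -> 0 < sin (pi * t).
Proof.
move=> /andP[t0 t1]; have p0 := @pi_gt0 R; apply: sin_gt0_pihalf.
by apply/andP; split; nra.
Qed.

Lemma continuous_invsqrt (x : R) : 0 < x -> {for x, continuous (fun y : R => (Num.sqrt y)^-1)}.
Proof.
move=> x0; apply: (@continuous_comp _ _ _ (@Num.sqrt R) (GRing.inv : R -> R)).
  exact: sqrt_continuous.
by apply: inv_continuous; rewrite gt_eqF// sqrtr_gt0.
Qed.

(** With x = A sin(pi t), dx = pi A cos(pi t) dt = pi sqrt(A^2 - x^2) dt: the arcsine density on a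
    quarter period. *)
Lemma arcsine_substitution (A : R) (g : R -> R) : 0 < A ->
  (forall x, 0 < x < A -> {for x, continuous g}) ->
  (forall x, 0 < x < A -> 0 <= g x) ->
  (\int[mu]_(t in H) (g (A * sin (pi * t)))%:E =
   \int[mu]_(x in `]0%R, A[) (g x * (Num.sqrt (A ^+ 2 - x ^+ 2))^-1 / pi)%:E)%E.
Proof.
move=> A0 cg g0; have p0 := @pi_gt0 R.
pose F (t : R) := A * sin (pi * t).
have F0 : F 0 = 0 by rewrite /F mulr0 sin0 mulr0.
have F1 : F (1 / 2) = A by rewrite /F sin_pi_half mulr1.
pose G (x : R) := g x * (Num.sqrt (A ^+ 2 - x ^+ 2))^-1 / pi.
have sub : (\int[mu]_(x in `]F 0%R, F (1 / 2)%R[) (G x)%:E =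
    \int[mu]_(t in H) (G (F t) * (A * (pi * cos (pi * t))))%:E)%E.
  apply: ge0_integration_by_substitution_oo.
  - lra.
  - by move=> t; apply: cvgM; [exact: cvg_cst|exact: continuous_sin_pi].
  - move=> t _; have := is_deriveZ A (is_derive_sin_pi t).
    by rewrite /GRing.scale/=.
  - by move=> t tH; rewrite !mulr_gt0// cos_pi_gt0.
  - move=> t _; apply: cvgM; first exact: cvg_cst.
    by apply: cvgM; [exact: cvg_cst|exact: continuous_cos_pi].
  - move=> x; rewrite F0 F1 => xA; apply: cvgM; last exact: cvg_cst.
    apply: cvgM; first exact: cg.
    apply: (@continuous_comp _ _ _ (fun x : R => A ^+ 2 - x ^+ 2) (fun y : R => (Num.sqrt y)^-1)).
      by apply: cvgB; [exact: cvg_cst|exact: exprn_continuous].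
    by apply: continuous_invsqrt; move: xA => /andP[x0 xA]; nra.
  - move=> x; rewrite F0 F1 => xA; apply: divr_ge0; last exact: ltW.
    by apply: mulr_ge0; [exact: g0|rewrite invr_ge0 sqrtr_ge0].
rewrite F0 F1 in sub; rewrite [RHS]sub.
apply: eq_integral => t /set_mem/=; rewrite in_itv/= => tH.
have c0 := cos_pi_gt0 t tH.
congr EFin; rewrite /G /F.
have -> : A ^+ 2 - (A * sin (pi * t)) ^+ 2 = (A * cos (pi * t)) ^+ 2.
  by rewrite !exprMn cos2sin2; ring.
rewrite sqrtr_sqr ger0_norm; last exact: ltW (mulr_gt0 A0 c0).
move: (@pi R) p0 (cos _) c0 (g _) => P P0 c c0 u; field; by rewrite !gt_eqF.
Qed.

Lemma asin_gt0_lt (k : R) : 0 < k < 1 -> 0 < asin k < pi / 2.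
Proof.
move=> /andP[k0 k1]; have p0 := @pi_gt0 R.
have kI : k \in `[(-1), 1]%R by rewrite in_itv/=; apply/andP; split; lra.
rewrite asin_ltpi2 ?andbT; last by apply/andP; split; lra.
rewrite -ltr_sin ?asinK ?sin0//; rewrite in_itv/=; first by apply/andP; split; lra.
by rewrite asin_geNpi2 ?asin_lepi2//; apply/andP; split; lra.
Qed.

(** The change of variables replaces sin(pi t) by k sin(pi t): k^2 - sin^2 becomes k^2 cos^2, and
    the Jacobian cancels its root. *)
Lemma elliptic_substitution (k : R) : 0 < k < 1 ->
  (\int[mu]_(t in H) ((Num.sqrt (k ^+ 2 - sin (pi * t) ^+ 2))^-1)%:E =
   \int[mu]_(t in H) ((Num.sqrt (1 - k ^+ 2 * sin (pi * t) ^+ 2))^-1)%:E)%E.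
Proof.
move=> k01; have /andP[k0 k1] := k01; have p0 := @pi_gt0 R.
have /andP[al0 al1] := asin_gt0_lt k k01.
have kI : k \in `[(-1), 1]%R by rewrite in_itv/=; apply/andP; split; lra.
pose F (t : R) := asin (k * sin (pi * t)) / pi.
pose f (t : R) := k * cos (pi * t) * (Num.sqrt (1 - (k * sin (pi * t)) ^+ 2))^-1.
have ks (t : R) : -1 < k * sin (pi * t) < 1.
  have := sin_geN1 (pi * t); have := sin_le1 (pi * t).
  by move=> s1 s2; apply/andP; split; nra.
have ks1 (t : R) : 0 < 1 - (k * sin (pi * t)) ^+ 2 by have /andP[] := ks t; nra.
have F0 : F 0 = 0.
  rewrite /F mulr0 sin0 mulr0 -[X in asin X](@sin0 R) sinK ?mul0r//.
  by rewrite in_itv/=; apply/andP; split; lra.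
have F1 : F (1 / 2) = asin k / pi by rewrite /F sin_pi_half mulr1.
have sin_mono (t : R) : 0 < t < 1 / 2 -> (sin (pi * t) < k) = (t < asin k / pi).
  move=> /andP[t0 t1]; rewrite -{1}(asinK kI) ltr_sin; last 2 first.
  - by rewrite in_itv/=; apply/andP; split; nra.
  - by rewrite in_itv/=; apply/andP; split; lra.
  by rewrite ltr_pdivlMr// mulrC.
(* Past [asin k / pi] the radicand is nonpositive and the integrand is 0 by convention, so the range
   shrinks to the image of [F]. *)
transitivity (\int[mu]_(t in `]F 0%R, F (1 / 2)%R[) ((Num.sqrt (k ^+ 2 - sin (pi * t) ^+ 2))^-1)%:E)%E.
  rewrite F0 F1 integral_mkcond [RHS]integral_mkcond; apply: eq_integral => t _.
  rewrite /patch !mem_setE !in_itv/=.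
  have al2 : asin k / pi < 1 / 2 by rewrite ltr_pdivrMr//; lra.
  have [tH|] := boolP (0 < t < 1 / 2); last first.
    by move=> tN; case: ifPn => // /andP[t0 ta]; move: tN; rewrite t0 (lt_trans ta).
  have /andP[t0 t1] := tH; rewrite t0/= -sin_mono//.
  case: ltP => // kt; rewrite ler0_sqrtr ?invr0//.
  by have := sin_pi_gt0 t tH; nra.
pose G (x : R) := (Num.sqrt (k ^+ 2 - sin (pi * x) ^+ 2))^-1.
have sub : (\int[mu]_(x in `]F 0%R, F (1 / 2)%R[) (G x)%:E =
    \int[mu]_(t in H) (G (F t) * f t)%:E)%E.
  apply: ge0_integration_by_substitution_oo.
  - lra.
  - move=> t; apply: cvgM; last exact: cvg_cst.
    apply: (@continuous_comp _ _ _ (fun t : R => k * sin (pi * t)) (@asin R)).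
      by apply: cvgM; [exact: cvg_cst|exact: continuous_sin_pi].
    by apply: continuous_asin.
  - move=> t _.
    have d1 : is_derive t 1 (fun t : R => k * sin (pi * t)) (k * (pi * cos (pi * t))).
      by have := is_deriveZ k (is_derive_sin_pi t); rewrite /GRing.scale/=.
    have d2 := @is_derive1_comp R (@asin R) (fun t : R => k * sin (pi * t)) t _ _ (is_derive1_asin (ks t)) d1.
    have := is_deriveZ pi^-1 d2.
    rewrite /GRing.scale/= => d3.
    have -> : F = (fun x : R => pi^-1 * (asin \o (fun t : R => k * sin (pi * t))) x).
      by apply/funext => x; rewrite /F mulrC.
    apply: is_derive_eq d3 _; rewrite /f /GRing.scale/=.
    have s0 : 0 < Num.sqrt (1 - (k * sin (pi * t)) ^+ 2) by rewrite sqrtr_gt0.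
    move: (@pi R) p0 (cos _) (Num.sqrt _) s0 => P P0 c s s0.
    by field; rewrite !gt_eqF.
  - move=> t tH; rewrite /f !mulr_gt0 ?cos_pi_gt0// invr_gt0 sqrtr_gt0//.
  - move=> t _; apply: cvgM.
      by apply: cvgM; [exact: cvg_cst|exact: continuous_cos_pi].
    apply: (@continuous_comp _ _ _ (fun t : R => 1 - (k * sin (pi * t)) ^+ 2) (fun y : R => (Num.sqrt y)^-1)).
      apply: cvgB; first exact: cvg_cst.
      apply: (@continuous_comp _ _ _ (fun t : R => k * sin (pi * t)) (fun x : R => x ^+ 2)); last exact: exprn_continuous.
      by apply: cvgM; [exact: cvg_cst|exact: continuous_sin_pi].
    exact: continuous_invsqrt.
  - move=> t; rewrite F0 F1 => /andP[t0 t1].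
    have tH : 0 < t < 1 / 2.
      by rewrite t0 (lt_trans t1)// ltr_pdivrMr//; lra.
    apply: (@continuous_comp _ _ _ (fun t : R => k ^+ 2 - sin (pi * t) ^+ 2) (fun y : R => (Num.sqrt y)^-1)).
      apply: cvgB; first exact: cvg_cst.
      apply: (@continuous_comp _ _ _ (fun t : R => sin (pi * t)) (fun x : R => x ^+ 2)); last exact: exprn_continuous.
      exact: continuous_sin_pi.
    apply: continuous_invsqrt; have := sin_pi_gt0 t tH.
    by move: t1; rewrite -sin_mono//; nra.
  - by move=> t _; rewrite invr_ge0 sqrtr_ge0.
rewrite [LHS]sub.
apply: eq_integral => t /set_mem/=; rewrite in_itv/= => tH; congr EFin.
have c0 := cos_pi_gt0 t tH.
rewrite /G /F (mulrC pi) divfK ?gt_eqF// asinK; last first.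
  by rewrite in_itv/=; have /andP[h1 h2] := ks t; rewrite !ltW.
have -> : k ^+ 2 - (k * sin (pi * t)) ^+ 2 = (k * cos (pi * t)) ^+ 2.
  by rewrite !exprMn cos2sin2; ring.
rewrite sqrtr_sqr ger0_norm; last exact: ltW (mulr_gt0 k0 c0).
rewrite /f mulrA mulVf ?mul1r ?exprMn//.
by rewrite gt_eqF// mulr_gt0.
Qed.

End density.

(** * Reduction to a quarter square and evaluation of the inner integral *)

Section final.
Context {R : realType}.
Notation mu := (@lebesgue_measure R).
Local Notation D := (`[0%R, 1%R]%classic : set R).
Local Notation H := (`]0%R, 1 / 2[%classic : set R).
Local Notation T := (measurableTypeR R).

Lemma measurable_invsqrt : measurable_fun setT (fun x : R => (Num.sqrt x)^-1).
Proof.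
apply: (measurableT_comp measurable_invr).
by apply: continuous_measurable_fun; exact: sqrt_continuous.
Qed.

Lemma measurable_sin_pi_fst : measurable_fun setT (fun z : T * T => sin (pi * z.1) : R).
Proof. exact: (measurableT_comp measurable_sin_pi (@measurable_fst _ _ T T)). Qed.

Lemma ge0_integral_ln_minus_prod_cos :
  (\int[mu]_(c in D) \int[mu]_(b in D) (ln_minus `|prod_cos b c|)%:E =
   2%:E * (2%:E * \int[mu]_(c in H) \int[mu]_(b in H)
     (ln_minus (4 * sin (pi * c) * sin (pi * b)))%:E))%E.
Proof.
have mlm : measurable_fun setT (fun z : T * T => (ln_minus (4 * (z.2 : R) * sin (pi * z.1)))%:E).
  apply/measurable_EFinP; apply: (measurableT_comp measurable_ln_minus).
  apply: measurable_funM; last exact: measurable_sin_pi_fst.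
  by apply: measurable_funM => //; exact: (@measurable_snd _ _ T T).
have lm0 (z : T * T) : (0 <= (ln_minus (4 * (z.2 : R) * sin (pi * z.1)))%:E)%E.
  by rewrite lee_fin ln_minus_ge0.
(* The inner integral as a function of |cos(pi c)|, so that the same symmetry applies to the outer
   variable. *)
pose K (v : R) := (\int[mu]_(b in H) (ln_minus (4 * v * sin (pi * b)))%:E)%E.
have mK : measurable_fun setT K.
  exact: (@measurable_fun_integral_section _ _ T T R mu H _ (measurable_itv _) mlm lm0).
have K0 v : (0 <= K v)%E by apply: integral_ge0 => b _; rewrite lee_fin ln_minus_ge0.
transitivity (\int[mu]_(c in D) (2%:E * K `|cos (pi * c)|%R))%E.
  apply: eq_integral => c _.
  have := @ge0_integral_abs_cos R (fun u => (ln_minus (4 * `|cos (pi * c)| * u))%:E).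
  move=> <-.
  - apply: eq_integral => b _; congr (ln_minus _)%:E.
    by rewrite /prod_cos !normrM ger0_norm// mulrAC.
  - apply/measurable_EFinP; apply: (measurableT_comp measurable_ln_minus).
    exact: measurable_funM.
  - by move=> u; rewrite lee_fin ln_minus_ge0.
have mKc : measurable_fun D (fun c : R => K `|cos (pi * c)|%R).
  apply: measurable_funTS; apply: (measurableT_comp mK).
  by apply: measurableT_comp => //; exact: measurable_cos_pi.
rewrite (@ge0_integralZl _ _ _ mu D (measurable_itv _) _ mKc)//.
by rewrite ge0_integral_abs_cos.
Qed.

(* For x >= 4 sin (pi c) this is 0, since Num.sqrt is 0 on negative numbers
   and 0^-1 = 0: no indicator function is needed. *)
Definition arcsine_integrand (c x : R) : R := ln_minus x * (Num.sqrt ((4 * sin (pi * c)) ^+ 2 - x ^+ 2))^-1 / pi.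

Lemma arcsine_integrand_ge0 c x : 0 <= arcsine_integrand c x.
Proof.
by rewrite /arcsine_integrand divr_ge0 ?pi_ge0// mulr_ge0 ?ln_minus_ge0// invr_ge0 sqrtr_ge0.
Qed.

Lemma measurable_arcsine_integrand : measurable_fun setT (fun z : T * T => (arcsine_integrand z.1 z.2)%:E).
Proof.
apply/measurable_EFinP; apply: measurable_funM => //; apply: measurable_funM.
  exact: (measurableT_comp measurable_ln_minus (@measurable_snd _ _ T T)).
apply: (measurableT_comp measurable_invsqrt); apply: measurable_funB.
  by apply: measurable_funX; apply: measurable_funM => //; exact: measurable_sin_pi_fst.
by apply: measurable_funX; exact: (@measurable_snd _ _ T T).
Qed.

Lemma continuous_ln_minus (x : R) : 0 < x -> {for x, continuous (@ln_minus R)}.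
Proof.
move=> x0; apply: (@continuous_max R _ (cst 0) (fun x => - ln x)); first exact: cvg_cst.
by apply: cvgN; exact: continuous_ln.
Qed.

(** The natural range ends at 4 sin(pi c). Since [ln_minus] vanishes from 1 on and the inverse root
    beyond that end, the range can be []0, 1[] for every [c], and the integrals can be exchanged. *)
Lemma integral_ln_minus_arcsine_integrand c : 0 < c < 1 / 2 ->
  (\int[mu]_(b in H) (ln_minus (4 * sin (pi * c) * sin (pi * b)))%:E =
   \int[mu]_(x in `]0%R, 1%R[) (arcsine_integrand c x)%:E)%E.
Proof.
move=> cH; have s0 := sin_pi_gt0 c cH; set A := 4 * sin (pi * c).
have A0 : 0 < A by rewrite mulr_gt0.
rewrite (@arcsine_substitution R A (@ln_minus R)) //; last 2 first.
- by move=> x /andP[x0 _]; exact: continuous_ln_minus.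
- by move=> x _; exact: ln_minus_ge0.
rewrite integral_mkcond [RHS]integral_mkcond; apply: eq_integral => x _.
rewrite /patch !mem_setE !in_itv/=; have [x0|x0] := ltP 0 x => //=.
have [xA|xA] := ltP x A; have [x1|x1] := ltP x 1 => //.
- by rewrite /ln_minus max_l ?mul0r ?mul0r// oppr_le0 ln_ge0.
- by rewrite /arcsine_integrand -/A ler0_sqrtr ?invr0 ?mulr0 ?mul0r//; nra.
Qed.

Definition modulus2 (x : R) : R := 1 - x ^+ 2 / 16.

Lemma half_period_hyp2F1 x : 0 < x < 1 ->
  (\int[mu]_(t in H) ((Num.sqrt (1 - modulus2 x * sin (pi * t) ^+ 2))^-1)%:E =
   (hyp2F1 (1 / 2) (1 / 2) 1 (modulus2 x) / 2)%:E)%E.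
Proof.
move=> /andP[x0 x1].
have k01 : 0 <= modulus2 x < 1 by rewrite /modulus2; apply/andP; split; nra.
have := @ge0_integral_abs_sin R (fun u => ((Num.sqrt (1 - modulus2 x * u ^+ 2))^-1)%:E).
under eq_integral do rewrite real_normK ?num_real//.
rewrite -hyp2F1_integral// => E.
rewrite EFinM E.
- rewrite muleC muleA -EFinM mulVf// mul1e//.
- apply/measurable_EFinP; apply: (measurableT_comp measurable_invsqrt).
  apply: measurable_funB => //; apply: measurable_funM => //.
- by move=> u; rewrite lee_fin invr_ge0 sqrtr_ge0.
Qed.

(** The constant collects 1/pi from the arcsine density, 1/4 from the root of 16 (k^2 - sin^2), and
    1/2 from the half period. *)
Lemma integral_arcsine_integrand x : 0 < x < 1 ->
  (\int[mu]_(c in H) (arcsine_integrand c x)%:E =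
   (ln_minus x * hyp2F1 (1 / 2) (1 / 2) 1 (modulus2 x) * (1 / (8 * pi)))%:E)%E.
Proof.
move=> x01; have /andP[x0 x1] := x01; have p0 := @pi_gt0 R.
pose k := Num.sqrt (modulus2 x).
have m01 : 0 < modulus2 x < 1 by rewrite /modulus2; apply/andP; split; nra.
have kk : k ^+ 2 = modulus2 x by rewrite sqr_sqrtr// ltW//; case/andP: m01.
have k01 : 0 < k < 1.
  case/andP: m01 => h0 h1; rewrite sqrtr_gt0 h0/=.
  have : 0 <= k by exact: sqrtr_ge0.
  by rewrite ltNge => ?; apply/negP => ?; nra.
have mdens : measurable_fun setT (fun c : R => (arcsine_integrand c x)%:E).
  exact: (measurableT_comp measurable_arcsine_integrand (@measurable_pair2 _ _ T T x)).
(* Replacing c by 1/2 - t turns sin into cos, and 16 cos^2 - x^2 = 16 (k^2 - sin^2) with k^2 =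
   [modulus2 x]. *)
have := @ge0_integral_reflect_itv R (1 / 2) 0 (1 / 2) (fun c => (arcsine_integrand c x)%:E).
rewrite subrr subr0 => <-//.
have lp0 : 0 <= ln_minus x / (4 * pi) by rewrite divr_ge0 ?ln_minus_ge0// mulr_ge0// ltW.
transitivity (\int[mu]_(t in H) ((ln_minus x / (4 * pi))%:E *
   ((Num.sqrt (k ^+ 2 - sin (pi * t) ^+ 2))^-1)%:E))%E.
  apply: eq_integral => t _; rewrite -EFinM /arcsine_integrand; congr EFin.
  have -> : sin (pi * (1 / 2 - t)) = cos (pi * t).
    rewrite (_ : pi * (1 / 2 - t) = - (pi * t) + pi / 2); last by field.
    by rewrite sinDpihalf cosN.
  have -> : (4 * cos (pi * t)) ^+ 2 - x ^+ 2 = 4 ^+ 2 * (k ^+ 2 - sin (pi * t) ^+ 2).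
    by rewrite kk /modulus2 exprMn cos2sin2; field.
  rewrite sqrtrM ?sqr_ge0// sqrtr_sqr (@ger0_norm _ 4)// !invfM.
  by ring.
have mS : measurable_fun H (fun t : R => ((Num.sqrt (k ^+ 2 - sin (pi * t) ^+ 2))^-1)%:E).
  apply/measurable_EFinP/measurable_funTS; apply: (measurableT_comp measurable_invsqrt).
  by apply: measurable_funB => //; apply: measurable_funX; exact: measurable_sin_pi.
rewrite (@ge0_integralZl _ _ _ mu H (measurable_itv _) _ mS)//.
rewrite elliptic_substitution// kk half_period_hyp2F1// -EFinM; congr EFin.
move: (ln_minus x) (hyp2F1 _ _ _ _) (@pi R) p0 => u v P P0.
by field; rewrite gt_eqF.
by move=> c; rewrite lee_fin arcsine_integrand_ge0.
Qed.

(** On this interval [hyp2F1] is an integral depending measurably on a parameter. *)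
Lemma measurable_hyp2F1_modulus2 : measurable_fun (`]0%R, 1%R[ : set R)
  (fun x => hyp2F1 (1 / 2) (1 / 2) 1 (1 - x ^+ 2 / 16)).
Proof.
apply/measurable_EFinP.
pose f (z : T * T) := ((Num.sqrt (1 - modulus2 z.2 * sin (pi * z.1) ^+ 2))^-1)%:E : \bar R.
have mf : measurable_fun setT f.
  apply/measurable_EFinP; apply: (measurableT_comp measurable_invsqrt).
  apply: measurable_funB => //; apply: measurable_funM; last first.
    by apply: measurable_funX; exact: measurable_sin_pi_fst.
  apply: measurable_funB => //; apply: measurable_funM => //.
  by apply: measurable_funX; exact: (@measurable_snd _ _ T T).
have f0 z : (0 <= f z)%E by rewrite lee_fin invr_ge0 sqrtr_ge0.
have mF := @measurable_fun_integral_section _ _ T T R mu D _ (measurable_itv _) mf f0.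
apply: eq_measurable_fun (measurable_funTS mF) => x /set_mem/=.
rewrite in_itv/= => /andP[x0 x1]; rewrite /= hyp2F1_integral//.
by apply/andP; split; nra.
Qed.

End final.

Theorem theorem2 (R : realType) :
  mahler_P3 R =
  ((- (1 / (2 * pi)))%:E *
   \int[@lebesgue_measure R]_(x in `[0%R, 1%R])
      (hyp2F1 (1/2) (1/2) 1 (1 - x ^+ 2 / 16) * ln x)%:E)%E.
Proof.
have p0 := @pi_gt0 R.
rewrite mahler_P3_ln_minus ge0_integral_ln_minus_prod_cos.
have mI : measurable (`]0%R, 1%R[ : set (measurableTypeR R)) by exact: measurable_itv.
have mH : measurable (`]0%R, 1 / 2[ : set (measurableTypeR R)) by exact: measurable_itv.
have -> : (\int[@lebesgue_measure R]_(c in `]0%R, (1 / 2)%R[)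
      \int[@lebesgue_measure R]_(b in `]0%R, (1 / 2)%R[)
        (ln_minus (4 * sin (pi * c) * sin (pi * b)))%:E =
    \int[@lebesgue_measure R]_(c in `]0%R, (1 / 2)%R[)
      \int[@lebesgue_measure R]_(x in `]0%R, 1%R[) (arcsine_integrand c x)%:E)%E.
  by apply: eq_integral => c /set_mem/=; rewrite in_itv/=; exact: integral_ln_minus_arcsine_integrand.
rewrite (@integral_tonelli_swap _ _ (measurableTypeR R) (measurableTypeR R) R
  (@lebesgue_measure R) (@lebesgue_measure R) `]0%R, 1 / 2[ `]0%R, 1%R[ _ mH mI
  measurable_arcsine_integrand (fun z => arcsine_integrand_ge0 z.1 z.2)).
pose q (x : R) := hyp2F1 (1 / 2) (1 / 2) 1 (1 - x ^+ 2 / 16).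
have mq : measurable_fun (`]0%R, 1%R[ : set R) q by exact: measurable_hyp2F1_modulus2.
have q0 (x : R) : 0 < x < 1 -> 0 <= q x.
  move=> /andP[x0 x1]; rewrite -lee_fin hyp2F1_integral; last by apply/andP; split; nra.
  by apply: integral_ge0 => t _; rewrite lee_fin invr_ge0 sqrtr_ge0.
have mlq : measurable_fun (`]0%R, 1%R[ : set R) (fun x => (ln_minus x * q x)%:E).
  apply/measurable_EFinP; apply: measurable_funM => //.
  by apply: measurable_funTS; exact: measurable_ln_minus.
have lq0 (x : R) : `]0%R, 1%R[%classic x -> (0 <= (ln_minus x * q x)%:E)%E.
  by rewrite /= in_itv/= => x01; rewrite lee_fin mulr_ge0 ?ln_minus_ge0 ?q0.
have -> : (\int[@lebesgue_measure R]_(x in `]0%R, 1%R[) \int[@lebesgue_measure R]_(c in `]0%R, (1 / 2)%R[) (arcsine_integrand c x)%:E =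
    (1 / (8 * pi))%:E * \int[@lebesgue_measure R]_(x in `]0%R, 1%R[) (ln_minus x * q x)%:E)%E.
  rewrite -(@ge0_integralZl _ _ _ (@lebesgue_measure R) _ mI _ mlq _ lq0); last first.
    by rewrite lee_fin divr_ge0// mulr_ge0// ltW.
  apply: eq_integral => x /set_mem/=; rewrite in_itv/= => x01.
  by rewrite integral_arcsine_integrand// -EFinM mulrC.
(* Inside the interval [ln_minus] is - ln, which accounts for the sign in the formula; the endpoints
   are null. *)
have -> : (\int[@lebesgue_measure R]_(x in `[0%R, 1%R]) (q x * ln x)%:E =
    - \int[@lebesgue_measure R]_(x in `]0%R, 1%R[) (ln_minus x * q x)%:E)%E.
  rewrite integral_itv_bndoo; last first.
    apply/measurable_EFinP; apply: measurable_funM => //.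
    by apply: measurable_funTS; exact: measurable_ln.
  rewrite -(@integral_ge0N _ _ _ (@lebesgue_measure R) _ _ lq0); apply: eq_integral => x /set_mem/=.
  rewrite in_itv/= => /andP[x0 x1]; transitivity (- (ln_minus x * q x))%:E; last by [].
  congr EFin; rewrite -/(q x).
  rewrite /ln_minus max_r; first by ring.
  by rewrite oppr_ge0 ln_le0// ltW.
(* The two symmetry factors and the density constant: 2 * 2 / (8 pi) = 1 / (2 pi). *)
rewrite muleN EFinN mulNe oppeK !muleA -!EFinM; congr (_%:E * _)%E.
by rewrite !mul1r invfM [in RHS]invfM mulrA; congr (_ * _); field.
Qed.
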